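(* Let $l\geqslant1$ and $g$ be as in the context, let $N\in\mathbb{N}$, $\kappa>0$, and let $(\omega_k)_{k\in\mathbb{Z}}$ be a sequence of non-negative real numbers. Put $$\widetilde g:=g-\frac1l\int_0^l g(t)\,dt,\qquad \|\omega\|_{N,2}:=\Big(\sum_{k=0}^{N-1}\omega_k^2\Big)^{1/2}.$$ Assume that $$\kappa\,\|\omega\|_{N,2}\leqslant\frac{3}{5000}\,\|\widetilde g\|_{L_2(0,l)}^2\,\frac{1}{l^7N^7}.$$ Then $$\lambda_{\kappa,\omega}(N)-1\geqslant\frac32\,\|\widetilde g\|_{L_2(0,l)}^2\,\frac{\kappa^2\,\|\omega\|_{N,2}^2}{l^3N^3}.$$
   Context: Let $l\geqslant 1$ and let $g\in C_0^2(0,l)$ be real-valued (twice continuously differentiable with compact support in $(0,l)$, extended by $0$ to $\mathbb{R}$), normalized by $\max\{\|g\|_{C[0,l]},\|g'\|_{C[0,l]},\|g''\|_{C[0,l]}\}=1$. Put $G(x_1,\omega):=\sum_{k\in\mathbb{Z}}\omega_k\,g(x_1-kl)$. For $\kappa>0$ and $N\in\mathbb{N}$ define the waveguide segment $$D_{\kappa,\omega}(N):=\{x\in\mathbb{R}^2\mid 0<x_1<Nl,\ \kappa G(x_1,\omega)<x_2<\kappa G(x_1,\omega)+\pi\},$$ and let $\Gamma_{\kappa,\omega}(N)$ be the lower and upper part of its boundary, i.e. the points with $0<x_1<Nl$ and $x_2=\kappa G(x_1,\omega)$ or $x_2=\kappa G(x_1,\omega)+\pi$. Let $\mathcal{H}_{\kappa,\omega}(N)$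 be the negative Laplace operator on $D_{\kappa,\omega}(N)$ with Dirichlet boundary conditions on $\Gamma_{\kappa,\omega}(N)$ and Neumann boundary conditions on the rest of the boundary (the vertical sides), and let $\lambda_{\kappa,\omega}(N)$ be its lowest eigenvalue. *)

(* Defs.v *)
From HB Require Import structures.
From mathcomp Require Import all_boot all_order all_algebra.
From mathcomp Require Import all_classical all_reals all_analysis.
Set Implicit Arguments.
Unset Strict Implicit.
Unset Printing Implicit Defensive.
Import Order.TTheory GRing.Theory Num.Theory.
Import numFieldNormedType.Exports.
Local Open Scope classical_set_scope.
Local Open Scope ring_scope.

(* All function spaces are real: the operator is real and self-adjoint, so its
   eigenvalues are real and each of them has a real eigenfunction. *)

Section OneVariable.
Variable R : realType.
Implicit Types (h : R -> R) (l : R).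

Definition C2_function h : Prop :=
  [/\ forall x, derivable h x 1,
      forall x, derivable (derive1 h) x 1
    & continuous (derive1 (derive1 h))].

Definition support h : set R := closure [set x | h x != 0].

Definition C20 l h : Prop :=
  [/\ C2_function h, compact (support h) & support h `<=` `]0, l[].

Definition Cnorm l h : R := sup [set `|h x| | x in `[0, l]].

Definition L2norm l h : R :=
  Num.sqrt (\int[lebesgue_measure]_(x in `]0, l[) (h x) ^+ 2).

Definition gtilde l h : R -> R :=
  fun x => h x - l^-1 * \int[lebesgue_measure]_(t in `[0, l]) h t.

Definition omega_norm (omega : int -> R) (N : nat) : R :=
  Num.sqrt (\sum_(k < N) (omega k%:Z) ^+ 2).

End OneVariable.

Section Laplacian.
Variable R : realType.
Implicit Types (D Gamma : set (R * R)) (u v f phi : R * R -> R).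

Local Notation lebesgue2 := (@lebesgue_measure R \x @lebesgue_measure R)%E.

Definition d1 f : R * R -> R := fun x => 'D_((1, 0) : R * R) f x.
Definition d2 f : R * R -> R := fun x => 'D_((0, 1) : R * R) f x.

Fixpoint Ck (k : nat) f : Prop :=
  continuous f /\
  if k is k'.+1 then
    [/\ forall x, derivable f x ((1, 0) : R * R),
        forall x, derivable f x ((0, 1) : R * R),
        Ck k' (d1 f)
      & Ck k' (d2 f)]
  else True.

Definition smooth f : Prop := forall k, Ck k f.

Definition L2 D f : Prop :=
  measurable_fun (D : set (measurableTypeR R * measurableTypeR R)) f /\
  lebesgue2.-integrable D (fun x => ((f x) ^+ 2)%:E).

Definition L2_cvg D (f_ : nat -> R * R -> R) f : Prop :=
  (fun n => \int[lebesgue2]_(x in D) ((f_ n x - f x) ^+ 2)%:E)%E @ \oo --> 0%E.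

(* Smooth up to the boundary of D (as restrictions from the whole plane) and
   zero in a neighbourhood of Gamma; unconstrained on the rest of the
   boundary of D. *)
Definition test_function Gamma phi : Prop :=
  smooth phi /\ closure [set x | phi x != 0] `&` closure Gamma = set0.

(* [form_domain D Gamma u p1 p2]: u is in the closure in W^1_2(D) of the test
   functions, i.e. in the form domain of the negative Laplacian with Dirichlet
   condition on Gamma and Neumann condition on the rest of the boundary, and
   (p1, p2) is the weak gradient of u. *)
Definition form_domain D Gamma u p1 p2 : Prop :=
  [/\ L2 D u, L2 D p1, L2 D p2 &
   exists phi : nat -> R * R -> R,
   [/\ forall n, test_function Gamma (phi n),
       L2_cvg D phi u,
       L2_cvg D (fun n => d1 (phi n)) p1
     & L2_cvg D (fun n => d2 (phi n)) p2]].

(* Graph of the self-adjoint operator associated with the closed form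
   u |-> \int_D |grad u|^2: u is in the domain of the operator, which maps it
   to f. *)
Definition neg_laplacian D Gamma u f : Prop :=
  L2 D f /\
  exists p1 p2, form_domain D Gamma u p1 p2 /\
  forall v q1 q2, form_domain D Gamma v q1 q2 ->
    \int[lebesgue2]_(x in D) (p1 x * q1 x + p2 x * q2 x) =
    \int[lebesgue2]_(x in D) (f x * v x).

Definition is_eigenvalue D Gamma (lambda : R) : Prop :=
  exists u, ~ {ae lebesgue2, forall x, D x -> u x = 0} /\
    neg_laplacian D Gamma u (fun x => lambda * u x).

Definition is_lowest_eigenvalue D Gamma (lambda : R) : Prop :=
  is_eigenvalue D Gamma lambda /\
  forall mu, is_eigenvalue D Gamma mu -> lambda <= mu.

End Laplacian.

Section Waveguide.
Variables (R : realType) (l : R) (g : R -> R) (kappa : R) (omega : int -> R).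

(* For g supported in (0, l) at most one term of this sum is nonzero, so the
   finitely supported sum is the usual one. *)
Definition G (x1 : R) : R :=
  \sum_(k \in [set: int]) omega k * g (x1 - k%:~R * l).

Definition waveguide (N : nat) : set (R * R) :=
  [set x | 0 < x.1 < N%:R * l /\
           kappa * G x.1 < x.2 < kappa * G x.1 + pi].

Definition waveguide_Gamma (N : nat) : set (R * R) :=
  [set x | 0 < x.1 < N%:R * l /\
           (x.2 = kappa * G x.1 \/ x.2 = kappa * G x.1 + pi)].

End Waveguide.

(* Main.v *)
(* For a vector field A with vanishing normal component on the vertical sides,
   |grad phi + phi A|^2 >= 0 and the divergence theorem give
   int |grad phi|^2 >= int (div A - |A|^2) phi^2 for every phi vanishing near
   the curved part of the boundary. In the sheared coordinate y = x2 - F(x1),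
   where F = kappa G and f = F', the field A = (s cot y + c, - t cot y - r) with
   coefficients depending only on x1 gives
     div A - |A|^2 = (f s + t - s^2 - t^2) cot^2 y + (s' - 2 s c - 2 t r) cot y
                     + (f s + t + c' - c^2 - r^2).
   The choice s' = - (2 / L^2) (F - mean F) with s = 0 at both ends, t and r
   making the first two brackets nonnegative and zero, and c' levelling the
   second order part of the last one to its mean over (0, L), L = N l, bounds it
   below by 1 + 2 V / L^3 up to terms of fourth order in F and f, which the
   smallness assumption absorbs; here V <= int_0^L (F - M)^2 for every constant
   M, and the variance of g over a single cell provides such a V. *)

Require Import Defs.
From mathcomp Require Import all_boot all_order all_algebra.
From mathcomp Require Import all_classical all_reals all_analysis.
From mathcomp Require Import measurable_realfun ring lra.
Set Implicit Arguments.
Unset Strict Implicit.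
Unset Printing Implicit Defensive.
Import Order.TTheory GRing.Theory Num.Theory.
Import numFieldNormedType.Exports.
Local Open Scope classical_set_scope.
Local Open Scope ring_scope.

(** * Measurability of continuous functions on the plane *)

(** The plane is second countable: an open set is the union of the countably many rational boxes
    that it contains, and each box is a product of two open intervals. *)
Lemma open_measurable_prod (R : realType) (U : set (R * R)) :
  open U -> measurable (U : set (measurableTypeR R * measurableTypeR R)).
Proof.
move=> oU.
pose box (q : rat * rat * rat) : set (R * R) :=
  ball (ratr q.1.1 : R) (ratr q.2 : R) `*` ball (ratr q.1.2 : R) (ratr q.2 : R).
have -> : U = \bigcup_q (if `[< box q `<=` U >] then box q else set0).
  apply/seteqP; split => [[x y] Uxy|z [q _]]; last first.
    by case: asboolP => // qU; exact: qU.
  have /nbhs_ballP[e /= e0 eU] : nbhs (x, y) U by apply: open_nbhs_nbhs.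
  have [r] := rat_in_itvoo (divr_gt0 e0 (ltr0n R 2)).
  rewrite in_itv /= => /andP[r0 re].
  have approx (t : R) : exists p : rat, `|ratr p - t| < (ratr r : R).
    have tr : t < t + ratr r by rewrite ltrDl.
    have [p] := rat_in_itvoo tr.
    rewrite in_itv /= => /andP[? ?]; exists p.
    by rewrite ltr_norml; apply/andP; split; lra.
  have [p px] := approx x; have [q qy] := approx y.
  exists ((p, q), r) => //; case: asboolP => [_|[]]; first by split.
  move=> [a b] [/= pa qb]; apply: eU; split => /=.
    apply: (@le_ball _ _ _ (ratr r + ratr r)); first by lra.
    by apply: (ball_triangle (y := ratr p : R)) => //; exact/ball_sym.
  apply: (@le_ball _ _ _ (ratr r + ratr r)); first by lra.
  by apply: (ball_triangle (y := ratr q : R)) => //; exact/ball_sym.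
apply: countable_bigcupT_measurable => // q; case: ifP => _ //.
apply: measurableX; apply: open_measurable; exact: ball_open.
Qed.

Lemma continuous_measurable_prod (R : realType) (h : R * R -> R)
    (D : set (measurableTypeR R * measurableTypeR R)) :
  continuous h -> measurable_fun D h.
Proof.
move=> ch; apply: measurable_funTS.
apply: (measurability _ (RGenOpens.measurableE R)).
move=> _ [_ [a [b ->] <-]]; rewrite setTI; apply: open_measurable_prod.
by move/continuousP : ch; apply; exact: interval_open.
Qed.

(** * One-variable calculus, and continuity along shears and sections *)

Lemma is_derive_continuous (R : realType) (f : R -> R) (x d : R) :
  is_derive x 1 f d -> {for x, continuous f}.
Proof.
by move=> df; apply/differentiable_continuous/derivable1_diffP; case: df.
Qed.

Lemma is_derive_same_increment (R : realType) (f g h : R -> R) (a b : R) :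
  a <= b ->
  (forall z : R, a <= z <= b -> is_derive z 1 f (h z)) ->
  (forall z : R, a <= z <= b -> is_derive z 1 g (h z)) ->
  f b - f a = g b - g a.
Proof.
move=> ab df dg.
have dfg (z : R) : a <= z <= b -> is_derive z 1 (f - g) 0.
  by move=> zab; have := df z zab; have := dg z zab => ? ?;
    apply: is_derive_eq; rewrite subrr.
have [||z _] := @MVT_segment R (f - g) (fun=> 0) a b ab.
- by move=> z; rewrite in_itv => /andP[/ltW az /ltW zb]; apply: dfg; rewrite az.
- apply: derivable_within_continuous => z; rewrite in_itv => zab.
  by case: (dfg z zab).
- rewrite mul0r; change ((f - g) b) with (f b - g b).
  by change ((f - g) a) with (f a - g a) => /eqP; lra.
Qed.

(** The integral from a fixed base point is a primitive only to the right of that point. Base point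
    -1 gives a primitive on (-1, oo), reflection gives one on (-oo, 1); normalized at 0, they agree
    on the overlap and glue. *)
Lemma continuous_primitive (R : realType) (h : R -> R) : continuous h ->
  exists P : R -> R, forall x : R, is_derive x 1 P (h x).
Proof.
move=> ch.
have right (k : R -> R) : continuous k ->
    exists P : R -> R, forall x : R, -1 < x -> is_derive x 1 P (k x).
  move=> ck; exists (fun x => \int[lebesgue_measure]_(t in `[-1, x]) k t) => x x1.
  have [] := @continuous_FTC1_closed R k (-1) x (x + 1) _ _ x1 (ck x).
  - by rewrite ltrDl.
  - apply: continuous_compact_integrable; first exact: segment_compact.
    exact: continuous_subspaceT.
  - by move=> dP vP; apply: DeriveDef; [exact: dP|rewrite -derive1E].
have [P1 dP1] := right h ch.
have [P2 dP2] : exists P : R -> R, forall x : R, x < 1 -> is_derive x 1 P (h x).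
  have [|P dP] := right (fun x => - h (- x)).
    move=> x; apply: continuousN; apply: continuous_comp; first exact: continuousN.
    exact: ch.
  exists (fun x => P (- x)) => x x1.
  have dP' : is_derive (- x) 1 P (- h x).
    by have := dP (- x); rewrite opprK; apply; lra.
  have := @is_derive1_comp R P -%R x _ _ dP' (is_deriveNid _ _).
  by rewrite mulrNN mulr1.
exists (fun x => if 0 < x then P1 x - P1 0 else P2 x - P2 0) => x.
have same (z : R) : -1 < z < 1 -> P1 z - P1 0 = P2 z - P2 0.
  move=> z1; have [z0|/ltW z0] := leP 0 z.
    by apply: (@is_derive_same_increment R _ _ h) => // t tz;
      [apply: dP1|apply: dP2]; lra.
  apply/eqP; rewrite -eqr_opp !opprB; apply/eqP.
  by apply: (@is_derive_same_increment R _ _ h) => // t tz;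
      [apply: dP1|apply: dP2]; lra.
have [x0|x0] := ltP 0 x.
  apply: (@near_eq_is_derive _ _ _ (fun x => P1 x - P1 0)).
    by near=> z; rewrite ifT//; near: z; exact: lt_nbhsr.
  have := dP1 x; rewrite (lt_trans _ x0)// => /(_ isT) ?.
  by apply: is_derive_eq; rewrite subr0.
apply: (@near_eq_is_derive _ _ _ (fun x => P2 x - P2 0)).
  near=> z; case: ifPn => // z0; rewrite same// (lt_trans _ z0) ?ltrN10//=.
  by near: z; apply: lt_nbhsl; rewrite (le_lt_trans x0).
have := dP2 x; rewrite (le_lt_trans x0)// => /(_ isT) ?.
by apply: is_derive_eq; rewrite subr0.
Unshelve. all: by end_near.
Qed.

Lemma continuous_at_pair (T U V : topologicalType) (f : T -> U) (g : T -> V) (x : T) :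
  {for x, continuous f} -> {for x, continuous g} ->
  {for x, continuous (fun x => (f x, g x))}.
Proof.
move=> cf cg.
exact: (@cvg_pair T U V (nbhs x) (nbhs (f x)) (nbhs (g x)) _ _ _ f g cf cg).
Qed.

Lemma continuous_shear (R : realType) (h : R * R -> R) (F : R -> R) :
  continuous h -> continuous F -> continuous (fun z => h (z.1, z.2 + F z.1)).
Proof.
move=> ch cF z.
apply: (@continuous_comp _ _ _ (fun z : R * R => (z.1, z.2 + F z.1)) h);
  last exact: ch.
apply: continuous_at_pair; first exact: cvg_fst.
apply: (@continuousD _ _ _ snd (F \o fst)); first exact: cvg_snd.
by apply: continuous_comp; [exact: cvg_fst|exact: cF].
Qed.

Lemma continuous_section1 (R : realType) (h : R * R -> R) (y : R) :
  continuous h -> continuous (fun x : R => h (x, y)).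
Proof.
move=> ch x; apply: (@continuous_comp _ _ _ (fun x : R => (x, y)) h); last exact: ch.
by apply: continuous_at_pair; [exact: cvg_id|exact: cvg_cst].
Qed.

Lemma continuous_section2 (R : realType) (h : R * R -> R) (x : R) :
  continuous h -> continuous (fun y : R => h (x, y)).
Proof.
move=> ch y; apply: (@continuous_comp _ _ _ (fun y : R => (x, y)) h); last exact: ch.
by apply: continuous_at_pair; [exact: cvg_cst|exact: cvg_id].
Qed.

Lemma integral_oo_is_derive (R : realType) (f P : R -> R) (a b : R) :
  a <= b -> continuous f ->
  (forall x : R, a <= x <= b -> is_derive x 1 P (f x)) ->
  (\int[lebesgue_measure]_(x in `]a, b[) (f x)%:E = (P b - P a)%:E)%E.
Proof.
rewrite le_eqVlt => /predU1P[<- _ _|ab cf dP].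
  by rewrite set_itv_ge ?bnd_simp ?ltxx// integral_set0 subrr.
have mf (D : set R) : measurable_fun D (fun x => (f x)%:E).
  by apply/measurable_EFinP; apply: measurable_funTS; exact: continuous_measurable_fun.
rewrite integral_itv_obnd_cbnd// integral_itv_bndo_bndc//.
rewrite (@continuous_FTC2 _ f P)//.
- exact: continuous_subspaceT.
- split.
  + move=> x /[!in_itv]/= /andP[/ltW ax /ltW xb].
    have xab : a <= x <= b by rewrite ax.
    by case: (dP x xab).
  + apply: cvg_at_right_filter.
    by apply: is_derive_continuous; apply: dP; rewrite lexx ltW.
  + apply: cvg_at_left_filter.
    by apply: is_derive_continuous; apply: dP; rewrite lexx ltW.
- move=> x /[!in_itv]/= /andP[/ltW ax /ltW xb].
  have /dP dPx : a <= x <= b by rewrite ax.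
  by rewrite derive1E derive_val.
Qed.

(** With a primitive [P] of [k], both sides equal [P (u + w) - P u]. *)
Lemma integral_oo_shift (R : realType) (k : R -> R) (u w : R) :
  0 <= w -> continuous k ->
  (\int[lebesgue_measure]_(y in `]u, (u + w)%R[) (k y)%:E =
   \int[lebesgue_measure]_(y in `]0%R, w[) (k (y + u)%R)%:E)%E.
Proof.
move=> w0 ck; have [P dP] := continuous_primitive ck.
rewrite (@integral_oo_is_derive _ k P) ?lerDl//.
rewrite -[P (u + w)](congr1 P (addrC w u)) -[P u](congr1 P (add0r u)).
apply/esym.
apply: (@integral_oo_is_derive _ (fun y => k (y + u)) (fun y => P (y + u))) => //.
- move=> x; apply: (@continuous_comp _ _ _ (fun y => y + u) k); last exact: ck.
  by apply: continuousD; [exact: cvg_id|exact: cvg_cst].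
- move=> x _.
  have d1 : is_derive x 1 (fun y : R => y + u) 1.
    by apply: is_derive_eq; rewrite addr0.
  by have := @is_derive1_comp R P (fun y => y + u) x _ _ (dP (x + u)) d1; rewrite mulr1.
Qed.

(** * Integration over rectangles and over strips between two graphs *)

Section rectangle.
Context {R : realType}.
Local Notation mu := (@lebesgue_measure R).
Local Notation mu2 := (mu \x mu)%E.
Local Notation rect a b c d := ((`]a, b[ `*` `]c, d[) : set (measurableTypeR R * measurableTypeR R)).

Lemma measurable_rect (a b c d : R) : measurable (rect a b c d).
Proof. by apply: measurableX; exact: measurable_itv. Qed.

(** A continuous function is bounded on the compact closed rectangle, and the open rectangle has
    finite measure. *)
Lemma integrable_rect (h : R * R -> R) (a b c d : R) :
  continuous h -> mu2.-integrable (rect a b c d) (EFin \o h).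
Proof.
move=> ch; apply: measurable_bounded_integrable.
- exact: measurable_rect.
- have fin : (mu2 (rect a b c d) < +oo)%E.
    rewrite product_measure1E; [|exact: measurable_itv|exact: measurable_itv].
    have fini (s t : R) : (mu `]s, t[%classic < +oo)%E.
      by rewrite (@lebesgue_measure_itv R `]s, t[)/=; case: ifP => _;
        rewrite -?EFinB ltry.
    apply: lte_mul_pinfty; [exact: measure_ge0| |exact: fini].
    by rewrite ge0_fin_numE ?fini// measure_ge0.
  exact: fin.
- exact: continuous_measurable_prod.
- have [M [_ hM]] : bounded_set (h @` (`[a, b] `*` `[c, d])).
    apply: compact_bounded; apply: continuous_compact.
      exact: continuous_subspaceT.
    by apply: compact_setX; exact: segment_compact.
  exists M; split; first exact: num_real.
  move=> e Me z [/= z1 z2]; apply: hM => //; exists z => //.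
  by split; [move: z1|move: z2]; rewrite /= !in_itv/= => /andP[/ltW -> /ltW ->].
Qed.

Lemma mem_itvoo (a b x : R) : (x \in `]a, b[%classic) = (a < x < b).
Proof. by rewrite mem_setE in_itv. Qed.

Lemma patch_rectE (h : R * R -> R) (a b c d x y : R) :
  ((EFin \o h) \_ (rect a b c d)) (x, y) =
  if (a < x < b) && (c < y < d) then (h (x, y))%:E else 0%E.
Proof.
rewrite patchE -!mem_itvoo; congr (if _ then _ else _).
by apply/idP/andP; rewrite !inE.
Qed.

Lemma rect_integral12 (h : R * R -> R) (a b c d : R) :
  continuous h ->
  (\int[mu2]_(z in rect a b c d) (h z)%:E =
   \int[mu]_(x in `]a, b[) \int[mu]_(y in `]c, d[) (h (x, y))%:E)%E.
Proof.
move=> ch; rewrite integral_mkcond -integral12_prod_meas1; last first.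
  by apply/(integrable_mkcond _ (measurable_rect a b c d)); exact: integrable_rect.
rewrite [RHS]integral_mkcond; apply: eq_integral => x _ /=.
rewrite /fubini_F patchE mem_itvoo; case: ifPn => xab.
  rewrite [RHS]integral_mkcond; apply: eq_integral => y _ /=.
  by rewrite patch_rectE patchE mem_itvoo xab.
by apply: integral0_eq => y _; rewrite patch_rectE (negbTE xab).
Qed.

Lemma rect_integral21 (h : R * R -> R) (a b c d : R) :
  continuous h ->
  (\int[mu2]_(z in rect a b c d) (h z)%:E =
   \int[mu]_(y in `]c, d[) \int[mu]_(x in `]a, b[) (h (x, y))%:E)%E.
Proof.
move=> ch; rewrite integral_mkcond -integral21_prod_meas1; last first.
  by apply/(integrable_mkcond _ (measurable_rect a b c d)); exact: integrable_rect.
rewrite [RHS]integral_mkcond; apply: eq_integral => y _ /=.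
rewrite /fubini_G patchE mem_itvoo; case: ifPn => ycd.
  rewrite [RHS]integral_mkcond; apply: eq_integral => x _ /=.
  by rewrite patch_rectE patchE mem_itvoo ycd andbT.
by apply: integral0_eq => x _; rewrite patch_rectE (negbTE ycd) andbF.
Qed.

(** Horizontal part of the divergence theorem: Fubini puts the x integral inside, where it is an
    increment of [W] and vanishes because the two boundary values agree. *)
Lemma rect_integral_d1 (W w : R * R -> R) (a b c d : R) :
  a <= b -> continuous w ->
  (forall x y : R, a <= x <= b -> c < y < d ->
     is_derive x 1 (fun x => W (x, y)) (w (x, y))) ->
  (forall y, c < y < d -> W (a, y) = W (b, y)) ->
  (\int[mu2]_(z in rect a b c d) (w z)%:E = 0)%E.
Proof.
move=> ab cw dW Wab; rewrite rect_integral21//.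
apply: integral0_eq => y /=; rewrite in_itv/= => ycd.
rewrite -[0%E]/(0%R%:E) -(subrr (W (b, y))) -[X in _ - X]Wab//.
apply: (@integral_oo_is_derive _ _ (fun x => W (x, y))) => //.
- exact: continuous_section1.
- by move=> x xab; exact: dW.
Qed.

Lemma rect_integral_d2 (W w : R * R -> R) (a b c d : R) :
  c <= d -> continuous w ->
  (forall x y : R, a < x < b -> c <= y <= d ->
     is_derive y 1 (fun y => W (x, y)) (w (x, y))) ->
  (forall x, a < x < b -> W (x, c) = W (x, d)) ->
  (\int[mu2]_(z in rect a b c d) (w z)%:E = 0)%E.
Proof.
move=> cd cw dW Wcd; rewrite rect_integral12//.
apply: integral0_eq => x /=; rewrite in_itv/= => xab.
rewrite -[0%E]/(0%R%:E) -(subrr (W (x, d))) -[X in _ - X]Wcd//.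
apply: (@integral_oo_is_derive _ _ (fun y => W (x, y))) => //.
- exact: continuous_section2.
- by move=> y ycd; exact: dW.
Qed.

(** The waveguide is this set with [w] equal to pi and [F] equal to kappa G over (0, L). *)
Definition strip (L w : R) (F : R -> R) : set (measurableTypeR R * measurableTypeR R) :=
  [set z | 0 < z.1 < L /\ F z.1 < z.2 < F z.1 + w].

Lemma measurable_strip (L w : R) (F : R -> R) :
  continuous F -> measurable (strip L w F).
Proof.
move=> cF; have cf : continuous (fun z : R * R => z.2 - F z.1).
  move=> z; apply: continuousB; first exact: cvg_snd.
  apply: continuous_comp; [exact: cvg_fst|exact: cF].
have -> : strip L w F = (`]0, L[ `*` setT) `&`
    (setT `&` ((fun z => z.2 - F z.1) @^-1` `]0, w[)).
  rewrite setTI; apply/seteqP; split => z /=; rewrite !in_itv/=.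
    by move=> [z1 /andP[? ?]]; split=> //; apply/andP; split; lra.
  by move=> [[z1 _] /andP[? ?]]; split=> //; apply/andP; split; lra.
apply: measurableI.
  by apply: measurableX => //; exact: measurable_itv.
apply: (continuous_measurable_prod (D := setT) cf) => //; exact: measurable_itv.
Qed.

(** The shear has Jacobian one: Tonelli, available because [h] is nonnegative, reduces the claim to
    a translation of each vertical section. *)
Lemma integral_strip (h : R * R -> R) (F : R -> R) (L w : R) :
  0 <= w -> continuous h -> (forall z, 0 <= h z) -> continuous F ->
  (\int[mu2]_(z in strip L w F) (h z)%:E =
   \int[mu2]_(z in rect 0%R L 0%R w) (h (z.1, (z.2 + F z.1)%R))%:E)%E.
Proof.
move=> w0 ch h0 cF.
rewrite (@rect_integral12 (fun z => h (z.1, (z.2 + F z.1)))); last exact: (continuous_shear ch cF).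
rewrite integral_mkcond fubini_tonelli1; last 2 first.
- apply/(measurable_restrictT _ (@measurable_strip L w F cF)).
  apply/measurable_EFinP; exact: continuous_measurable_prod.
- by move=> z; rewrite patchE; case: ifP => // _; rewrite lee_fin.
rewrite [RHS]integral_mkcond; apply: eq_integral => x _ /=.
rewrite /fubini_F patchE mem_itvoo; case: ifPn => xL.
  rewrite -(@integral_oo_shift _ (fun y => h (x, y)))//; last exact: continuous_section2.
  rewrite [RHS]integral_mkcond; apply: eq_integral => y _ /=.
  rewrite !patchE mem_itvoo; congr (if _ then _ else _).
  by apply/idP/idP; rewrite !inE; [case|split].
apply: integral0_eq => y _; rewrite patchE ifN// notin_setE => -[/= xL' _].
by rewrite xL' in xL.
Qed.
End rectangle.

(** * Partial derivatives in sheared coordinates *)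

Lemma is_derive_cvg (R : realType) (f : R -> R) (x d : R) :
  (fun h => h^-1 * (f (h + x) - f x)) @ 0^' --> d -> is_derive x 1 f d.
Proof.
move=> fd; have E : (fun h : R => h^-1 *: (f (h *: 1 + x) - f x)) =
    (fun h => h^-1 * (f (h + x) - f x)).
  by apply/funext => h; rewrite /GRing.scale/= mulr1.
apply: DeriveDef; first by apply/cvg_ex; exists d; rewrite E.
by rewrite /derive E; exact/cvg_lim.
Qed.

Section partial.
Context {R : realType} (phi : R * R -> R).

Lemma is_derive_d1 (x y : R) : derivable phi (x, y) ((1, 0) : R * R) ->
  is_derive x 1 (fun x => phi (x, y)) (d1 phi (x, y)).
Proof.
move=> dphi; have E : (fun h : R => h^-1 *: (phi (h *: 1 + x, y) - phi (x, y))) =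
    (fun h : R => h^-1 *: (phi (h *: ((1, 0) : R * R) + (x, y)) - phi (x, y))).
  apply/funext => h; congr (_ *: (phi _ - _)).
  by rewrite -[RHS]/(h *: 1 + x, h *: 0 + y) scaler0 add0r.
apply: DeriveDef; first by rewrite /derivable E.
by rewrite /derive E.
Qed.

Lemma is_derive_d2 (x y : R) : derivable phi (x, y) ((0, 1) : R * R) ->
  is_derive y 1 (fun y => phi (x, y)) (d2 phi (x, y)).
Proof.
move=> dphi; have E : (fun h : R => h^-1 *: (phi (x, h *: 1 + y) - phi (x, y))) =
    (fun h : R => h^-1 *: (phi (h *: ((0, 1) : R * R) + (x, y)) - phi (x, y))).
  apply/funext => h; congr (_ *: (phi _ - _)).
  by rewrite -[RHS]/(h *: 0 + x, h *: 1 + y) scaler0 add0r.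
apply: DeriveDef; first by rewrite /derivable E.
by rewrite /derive E.
Qed.

Hypothesis dphi1 : forall z, derivable phi z ((1, 0) : R * R).
Hypothesis dphi2 : forall z, derivable phi z ((0, 1) : R * R).
Hypothesis cphi1 : continuous (d1 phi).

(** The distance of [t] to [x] is controlled uniformly in [y], because the chain rule below lets [y]
    move together with [h]. *)
Lemma MVT_d1 (x h y : R) : exists2 t, `|t - x| <= `|h| &
  phi (h + x, y) - phi (x, y) = h * d1 phi (t, y).
Proof.
have mvt (a b : R) : a <= b -> exists2 t, a <= t <= b &
    phi (b, y) - phi (a, y) = d1 phi (t, y) * (b - a).
  move=> ab; have [||t] := @MVT_segment R (fun x => phi (x, y)) (fun x => d1 phi (x, y)) a b ab.
  - by move=> z _; exact: is_derive_d1.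
  - apply: derivable_within_continuous => z _.
    by case: (is_derive_d1 (@dphi1 (z, y))).
  - by rewrite in_itv; exists t.
have [h0|/ltW h0] := leP 0 h.
  have [|t tx ->] := mvt x (h + x); first by lra.
  by exists t; [rewrite (ger0_norm h0) ger0_norm; lra|rewrite addrK mulrC].
have [|t tx E] := mvt (h + x) x; first by lra.
exists t; first by rewrite (ler0_norm h0) ler0_norm; lra.
by rewrite -opprB E; ring.
Qed.

(** Only partial derivatives are given, so the increment is split in two. Moving the second argument
    is a one-variable chain rule; moving the first one at height y + F (x + h) is handled by the
    mean value theorem and the joint continuity of [d1 phi]. *)
Lemma is_derive_shear1 (F : R -> R) (x y f : R) : is_derive x 1 F f ->
  is_derive x 1 (fun x => phi (x, y + F x))
    (d1 phi (x, y + F x) + f * d2 phi (x, y + F x)).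
Proof.
move=> dF.
have dyF : is_derive x 1 (fun x => y + F x) f by apply: is_derive_eq; rewrite add0r mul1r.
have dk := @is_derive1_comp R (fun t => phi (x, t)) (fun x => y + F x) x _ _
  (is_derive_d2 (@dphi2 (x, y + F x))) dyF.
have dr : is_derive x 1 (fun z => phi (z, y + F z) - phi (x, y + F z))
    (d1 phi (x, y + F x)).
  apply: is_derive_cvg; apply/cvgrPdist_le => e e0.
  have := @cphi1 (x, y + F x) => /cvgrPdist_le/(_ e e0)/nbhs_ballP[r /= r0 hr].
  have cF : {for x, continuous F} by exact: is_derive_continuous dF.
  have /cvgrPdist_lt/(_ r r0) nF := cF.
  have nF' : \forall h \near 0^', `|F x - F (h + x)| < r.
    have : (fun h : R => h + x) @ 0^' --> x.
      rewrite -[X in _ --> X]add0r; apply: cvgD; last exact: cvg_cst.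
      exact: cvg_within.
    by move/(_ _ nF).
  near=> h.
  have h0 : h != 0 by near: h; exact: nbhs_dnbhs_neq.
  have hr' : `|h| < r.
    by near: h; apply: dnbhs0_lt.
  have [t th ->] := MVT_d1 x h (y + F (h + x)).
  rewrite subrr subr0 mulKf//; apply: hr; split => /=.
    by rewrite /ball/= distrC (le_lt_trans th).
  rewrite /ball/= opprD addrACA subrr add0r.
  by near: h.
have -> : (fun x => phi (x, y + F x)) =
    (fun z => phi (z, y + F z) - phi (x, y + F z)) + (fun z => phi (x, y + F z)).
  by apply/funext => z; rewrite -[RHS]/(_ - _ + _) subrK.
by apply: is_derive_eq; rewrite mulrC.
Unshelve. all: by end_near. Qed.

End partial.

(** * Continuity of algebraic expressions *)

Lemma continuous_comp_fst (R : realType) (k : R -> R) :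
  continuous k -> continuous (fun z : R * R => k z.1).
Proof. by move=> ck z; apply: continuous_comp; [exact: cvg_fst|exact: ck]. Qed.

Lemma continuous_comp_snd (R : realType) (k : R -> R) :
  continuous k -> continuous (fun z : R * R => k z.2).
Proof. by move=> ck z; apply: continuous_comp; [exact: cvg_snd|exact: ck]. Qed.

Lemma is_derive_cotan (R : realType) (y : R) : sin y != 0 ->
  is_derive y 1 (fun y : R => cos y / sin y) (- (1 + (cos y / sin y) ^+ 2)).
Proof.
move=> sy.
have dV : is_derive y 1 (fun y : R => (sin y)^-1) (- (sin y) ^- 2 *: cos y).
  exact: is_deriveV.
apply: is_derive_eq; rewrite /GRing.scale/=.
by field.
Qed.

Section continuous_pointwise.
Context {R : realType} {T : topologicalType}.
Implicit Types (h k : T -> R) (z : T).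

Lemma continuous_addf h k z : continuous_at z h -> continuous_at z k ->
  continuous_at z (fun z => h z + k z).
Proof. exact: continuousD. Qed.

Lemma continuous_oppf k z : continuous_at z k -> continuous_at z (fun z => - k z).
Proof. exact: continuousN. Qed.

Lemma continuous_mulf h k z : continuous_at z h -> continuous_at z k ->
  continuous_at z (fun z => h z * k z).
Proof. exact: continuousM. Qed.

Lemma continuous_sqrf k z : continuous_at z k ->
  continuous_at z (fun z => k z ^+ 2).
Proof. by move=> ck; exact: (continuousM ck ck). Qed.

Lemma continuous_cstf (a : R) z : continuous_at z (fun=> a).
Proof. exact: cvg_cst. Qed.

End continuous_pointwise.

(** Descends through sums, opposites, products and squares. Any other atom has to be covered by a
    [continuous] hypothesis, which is why such facts are put into the context beforehand. *)
Ltac solve_continuous_at := lazymatch goal with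
  | |- continuous_at ?z (fun x => @?a x + @?b x) =>
      refine (@continuous_addf _ _ a b z _ _); cbv beta; solve_continuous_at
  | |- continuous_at ?z (fun x => - @?a x) =>
      refine (@continuous_oppf _ _ a z _); cbv beta; solve_continuous_at
  | |- continuous_at ?z (fun x => @?a x * @?b x) =>
      refine (@continuous_mulf _ _ a b z _ _); cbv beta; solve_continuous_at
  | |- continuous_at ?z (fun x => @?a x ^+ 2) =>
      refine (@continuous_sqrf _ _ a z _); cbv beta; solve_continuous_at
  | |- continuous_at ?z (fun _ => ?a) => refine (@continuous_cstf _ _ a z)
  | |- continuous_at ?z (fun x => x) => exact (fun _ => id)
  | |- _ => match goal with H : continuous _ |- _ => simple apply H end
  end.

Ltac solve_continuous := let z := fresh "z" in move=> z; solve_continuous_at.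

(** * The calibration inequality on a rectangle *)

Section calibration.
Context {R : realType}.
Local Notation mu := (@lebesgue_measure R).
Local Notation mu2 := (mu \x mu)%E.
Local Notation rect a b c d := ((`]a, b[ `*` `]c, d[) : set (measurableTypeR R * measurableTypeR R)).

(** [P], [A], [B] stand for phi and its two partial derivatives in sheared coordinates, whence the
    horizontal derivative A + f B of [P]. The bounds on [a] and [b] keep y away from the poles of
    the cotangent. Adding to A^2 + B^2 two derivatives of integral zero turns it into Lam P^2 plus
    squares and a nonnegative multiple of P^2. *)
Lemma calibration_integral (L a b Lam : R) (f s s' c c' t r : R -> R)
    (P A B : R * R -> R) :
  0 <= L -> 0 < a -> a <= b -> b < pi ->
  continuous f -> continuous t -> continuous r ->
  continuous s' -> continuous c' ->
  (forall x : R, is_derive x 1 s (s' x)) -> (forall x : R, is_derive x 1 c (c' x)) ->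
  s 0 = 0 -> s L = 0 -> c 0 = 0 -> c L = 0 ->
  continuous P -> continuous A -> continuous B ->
  (forall x y : R, is_derive x 1 (fun x => P (x, y)) (A (x, y) + f x * B (x, y))) ->
  (forall x y : R, is_derive y 1 (fun y => P (x, y)) (B (x, y))) ->
  (forall x, 0 < x < L -> P (x, a) = 0 /\ P (x, b) = 0) ->
  (forall x, 0 < x < L -> [/\ 0 <= f x * s x + t x - s x ^+ 2 - t x ^+ 2,
     s' x - 2 * s x * c x - 2 * t x * r x = 0 &
     Lam <= f x * s x + t x + c' x - c x ^+ 2 - r x ^+ 2]) ->
  (\int[mu2]_(z in rect 0%R L a b) (Lam * P z ^+ 2)%:E <=
   \int[mu2]_(z in rect 0%R L a b) (A z ^+ 2 + B z ^+ 2)%:E)%E.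
Proof.
move=> L0 a0 ab bpi cf ct cr cs' cc' ds dc s0 sL c0 cL cP cA cB dP1 dP2 Pab H.
have sin0 y : a <= y <= b -> 0 < sin y.
  by move=> /andP[ay yb]; apply: sin_gt0_pi; rewrite (lt_le_trans a0 ay) (le_lt_trans yb bpi).
have [y0 y0ab sinmin] := @EVT_min R sin a b ab (continuous_subspaceT (@continuous_sin R)).
pose q := sin y0.
have q0 : 0 < q by apply: sin0; move: y0ab; rewrite in_itv.
(* Truncated so as to be continuous on the whole line. *)
pose cot y := cos y / Num.max (sin y) q.
have cotE y : a <= y <= b -> cot y = cos y / sin y.
  move=> yab; rewrite /cot max_l//; apply: sinmin; by rewrite in_itv.
have cs : continuous s by move=> x; exact: is_derive_continuous (ds x).
have cc : continuous c by move=> x; exact: is_derive_continuous (dc x).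
have ccot : continuous cot.
  move=> y; apply: (@continuousM _ _ cos (fun y => (Num.max (sin y) q)^-1)).
    exact: continuous_cos.
  apply: (@continuousV _ _ (fun y => Num.max (sin y) q)).
    by rewrite gt_eqF// lt_max q0 orbT.
  apply: (@continuous_max _ _ sin (fun=> q)); first exact: continuous_sin.
  exact: cvg_cst.
have := continuous_comp_fst cf; have := continuous_comp_fst ct.
have := continuous_comp_fst cr; have := continuous_comp_fst cs'.
have := continuous_comp_fst cc'; have := continuous_comp_fst cs.
have := continuous_comp_fst cc; have := continuous_comp_snd ccot.
move=> Ccot Cc Cs Cc' Cs' Cr Ct Cf.
(* On the rectangle [w1] is the x-derivative of (s cot y + c) P^2 and [w2] the y-derivative of -((t
   + f s) cot y + r + f c) P^2. Their sum is the divergence of P^2 times the field, since the shear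
   turns d/dx1 into d/dx - f d/dy. *)
pose w1 (z : R * R) := (s' z.1 * cot z.2 + c' z.1) * P z ^+ 2 +
  (s z.1 * cot z.2 + c z.1) * (2 * P z * (A z + f z.1 * B z)).
pose w2 (z : R * R) := (t z.1 + f z.1 * s z.1) * (1 + cot z.2 ^+ 2) * P z ^+ 2 -
  ((t z.1 + f z.1 * s z.1) * cot z.2 + r z.1 + f z.1 * c z.1) * (2 * P z * B z).
have cw1 : continuous w1.
  rewrite /w1.
  solve_continuous.
have cw2 : continuous w2.
  rewrite /w2.
  solve_continuous.
(* The boundary terms of [w1] vanish because [s] and [c] are zero at 0 and L, those of [w2] because
   [P] is zero at y = a and y = b. *)
have int1 : (\int[mu2]_(z in rect 0%R L a b) (w1 z)%:E = 0)%E.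
  apply: (@rect_integral_d1 _ (fun z => (s z.1 * (cos z.2 / sin z.2) + c z.1) * P z ^+ 2));
    [exact: L0|exact: cw1| |].
    move=> x y _ /andP[/ltW ay /ltW yb] /=.
    have := dP1 x y; have := ds x; have := dc x => ? ? ?.
    apply: is_derive_eq; rewrite /w1/= cotE ?ay// /GRing.scale/=; ring.
  by move=> y _ /=; rewrite s0 sL c0 cL !mul0r !add0r !mul0r.
have int2 : (\int[mu2]_(z in rect 0%R L a b) (w2 z)%:E = 0)%E.
  apply: (@rect_integral_d2 _ (fun z => - (((t z.1 + f z.1 * s z.1) * (cos z.2 / sin z.2) +
      r z.1 + f z.1 * c z.1) * P z ^+ 2)));
    [exact: ab|exact: cw2| |].
    move=> x y _ yab /=.
    have := dP2 x y; have := is_derive_cotan (lt0r_neq0 (sin0 y yab)) => dcot dP.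
    apply: is_derive_eq; rewrite /w2/= cotE// /GRing.scale/=; ring.
  by move=> x x0L /=; have [-> ->] := Pab x x0L; rewrite !expr0n/= !mulr0.
have intAB : (\int[mu2]_(z in rect 0%R L a b) (A z ^+ 2 + B z ^+ 2 + w1 z + w2 z)%:E =
   \int[mu2]_(z in rect 0%R L a b) (A z ^+ 2 + B z ^+ 2)%:E)%E.
  transitivity (\int[mu2]_(z in rect 0%R L a b) ((A z ^+ 2 + B z ^+ 2)%:E + (w1 z)%:E + (w2 z)%:E))%E.
    by [].
  have mrect := @measurable_rect R 0 L a b.
  have iw1 := @integrable_rect R w1 0 L a b cw1.
  have iw2 := @integrable_rect R w2 0 L a b cw2.
  have iAB : mu2.-integrable (rect 0 L a b) (EFin \o (fun z => A z ^+ 2 + B z ^+ 2)).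
    by apply: integrable_rect; solve_continuous.
  rewrite integralD//; last exact: integrableD.
  by rewrite integralD// int1 int2 !adde0.
rewrite -intAB; apply: le_integral.
- exact: measurable_rect.
- apply: (@integrable_rect _ (fun z => Lam * P z ^+ 2)).
  solve_continuous.
- apply: (@integrable_rect _ (fun z => A z ^+ 2 + B z ^+ 2 + w1 z + w2 z)).
  solve_continuous.
move=> [x y] /[!inE] -[/=]; rewrite !in_itv/= => xL /andP[/ltW ay /ltW yb].
have [H1 H2 H3] := H x xL.
rewrite lee_fin /w1 /w2/=; set u := cot y.
set p := P (x, y); set al := A (x, y); set be := B (x, y).
rewrite -subr_ge0.
(* Completion of squares: the first two squares are the squared length of grad phi plus phi times
   the field, and the rest is P^2 times a quadratic polynomial in the cotangent [u]. *)
have -> : al ^+ 2 + be ^+ 2 +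
  ((s' x * u + c' x) * p ^+ 2 + (s x * u + c x) * (2 * p * (al + f x * be))) +
  ((t x + f x * s x) * (1 + u ^+ 2) * p ^+ 2 -
   ((t x + f x * s x) * u + r x + f x * c x) * (2 * p * be)) - Lam * p ^+ 2 =
  (al + (s x * u + c x) * p) ^+ 2 + (be - (t x * u + r x) * p) ^+ 2 +
  p ^+ 2 * (u ^+ 2 * (f x * s x + t x - s x ^+ 2 - t x ^+ 2) +
     u * (s' x - 2 * s x * c x - 2 * t x * r x) +
     (f x * s x + t x + c' x - c x ^+ 2 - r x ^+ 2 - Lam)) by ring.
rewrite H2 mulr0 addr0.
apply: addr_ge0; first by apply: addr_ge0; exact: sqr_ge0.
apply: mulr_ge0; first exact: sqr_ge0.
apply: addr_ge0; last by rewrite subr_ge0.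
by apply: mulr_ge0 => //; exact: sqr_ge0.
Qed.

End calibration.

(** * From the rectangle to the curved strip *)

(** The graph over the compact [0, L] lies in the closure of [Gam], hence in the open complement of
    the support of [phi]; compactness makes the width [e] uniform in x. *)
Lemma vanish_near_graph (R : realType) (phi : R * R -> R) (Gam : set (R * R))
    (k : R -> R) (L : R) :
  0 < L -> continuous k ->
  (forall x, 0 < x < L -> Gam (x, k x)) ->
  closure [set z | phi z != 0] `&` closure Gam = set0 ->
  exists2 e : R, 0 < e & forall x y, 0 <= x <= L -> `|y| < e -> phi (x, k x + y) = 0.
Proof.
move=> L0 ck kG disj.
have ckp : continuous (fun x : R => (x, k x)).
  by move=> x; apply: continuous_at_pair; [exact: cvg_id|exact: ck].
have clG x : 0 <= x <= L -> closure Gam (x, k x).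
  move=> xL U /ckp /nbhs_ballP[e /= e0 eU].
  (* [Gam] is given over the open interval only, so x is clamped to [m/3, L - m/3] with m = min(e,
     L): the result lies in (0, L) and within [e] of x. *)
  pose x' := Num.max (Num.min x (L - Num.min e L / 3)) (Num.min e L / 3).
  have m0 : 0 < Num.min e L by rewrite lt_min e0.
  have [me mL] : Num.min e L <= e /\ Num.min e L <= L by rewrite !ge_min !lexx orbT.
  have x'L : 0 < x' < L /\ `|x - x'| < e.
    rewrite /x'; move: m0 me mL; set m := Num.min e L => m0 me mL.
    have [h1|h1] := leP x (L - m / 3).
      have [h2|h2] := leP x (m / 3); split; rewrite ?ltr_norml; lra.
    have [h2|h2] := leP (L - m / 3) (m / 3); split; rewrite ?ltr_norml; lra.
  exists (x', k x'); split; first exact: kG x'L.1.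
  by apply: eU; exact: x'L.2.
(* Compactness in its near-covering form: a property holding jointly near each (x, 0) holds, for all
   small y, on the whole segment at once. *)
have := @segment_compact R 0 L; rewrite compact_near_coveringP => cov.
have /nbhs_ballP[e /= e0 he] : \forall y \near (0 : R), `[0, L] `<=` (fun x => phi (x, k x + y) = 0).
  apply: (cov R (nbhs (0 : R)) (fun y x => phi (x, k x + y) = 0)) => x /=.
  rewrite in_itv/= => xL.
  have nz : nbhs (x, k x + 0) (~` closure [set z | phi z != 0]).
    rewrite addr0; apply: open_nbhs_nbhs; split.
      exact/closed_openC/closed_closure.
    move=> /= cl; have : (closure [set z | phi z != 0] `&` closure Gam) (x, k x) by split => //; exact: clG.
    by rewrite disj.
  have cm : continuous (fun z : R * R => (z.1, k z.1 + z.2)).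
    move=> z; apply: continuous_at_pair; first exact: cvg_fst.
    have c1 := continuous_comp_fst ck.
    have c2 : continuous (fun z : R * R => z.2) by move=> ?; exact: cvg_snd.
    have c12 : continuous (fun z : R * R => k z.1 + z.2) by solve_continuous.
    exact: c12.
  have nc0 := cm (x, 0) _ nz.
  apply: (@filterS _ (filter_prod (nbhs x) (nbhs (0 : R))) _ _ _ _ nc0).
  move=> -[x' y] /= nc; apply: contrapT => /eqP nphi; apply: nc.
  by apply: (@subset_closure _ [set z | phi z != 0]).
exists e => // x y xL ye; apply: (he y) => //=.
by rewrite /ball/= sub0r normrN.
Qed.

(** After the shear, the test function vanishes within [e] of y = 0 and y = pi, so the rectangle
    inequality applies on [e, pi - e]. The cut does not change the integral of phi^2, and the
    gradient integral only grows when the full strip is restored. *)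
Lemma calibration_strip (R : realType) (L Lam : R) (F f s s' c c' t r : R -> R)
    (Gam : set (R * R)) (phi : R * R -> R) :
  0 < L -> 0 <= Lam ->
  continuous f -> continuous t -> continuous r -> continuous s' -> continuous c' ->
  (forall x : R, is_derive x 1 F (f x)) ->
  (forall x : R, is_derive x 1 s (s' x)) -> (forall x : R, is_derive x 1 c (c' x)) ->
  s 0 = 0 -> s L = 0 -> c 0 = 0 -> c L = 0 ->
  (forall x, 0 < x < L -> [/\ 0 <= f x * s x + t x - s x ^+ 2 - t x ^+ 2,
     s' x - 2 * s x * c x - 2 * t x * r x = 0 &
     Lam <= f x * s x + t x + c' x - c x ^+ 2 - r x ^+ 2]) ->
  (forall x, 0 < x < L -> Gam (x, F x) /\ Gam (x, F x + pi)) ->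
  test_function Gam phi ->
  (Lam%:E * \int[(@lebesgue_measure R \x @lebesgue_measure R)%E]_(z in strip L pi F) (phi z ^+ 2)%:E <=
   \int[(@lebesgue_measure R \x @lebesgue_measure R)%E]_(z in strip L pi F)
      (d1 phi z ^+ 2 + d2 phi z ^+ 2)%:E)%E.
Proof.
move=> L0 Lam0 cf ct cr cs' cc' dF ds dc s0 sL c0 cL H GamF [sphi disj].
have cF : continuous F by move=> x; exact: is_derive_continuous (dF x).
have [cphi [dphi1 dphi2 [cphi1 _] [cphi2 _]]] := sphi 1%N.
have [e1 e10 he1] := vanish_near_graph L0 cF (fun x xL => (GamF x xL).1) disj.
have cFpi : continuous (fun x => F x + pi).
  move=> x; apply: (@continuousD _ _ _ F (fun=> pi)); [exact: cF|exact: cvg_cst].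
have [e2 e20 he2] := vanish_near_graph L0 cFpi (fun x xL => (GamF x xL).2) disj.
(* The division by 3 gives strict inequalities with [e1] and [e2] and leaves e < pi - e. *)
pose e := Num.min (Num.min e1 e2) pi / 3.
have pi0 := pi_gt0 R.
have e0 : 0 < e by rewrite divr_gt0// !lt_min e10 e20 pi0.
have [ee1 ee2 epi] : [/\ e < e1, e < e2 & 3 * e <= pi].
  rewrite /e; set m := Num.min _ pi.
  have m0 : 0 < m by rewrite !lt_min e10 e20 pi0.
  have [h1 h2 h3] : [/\ m <= e1, m <= e2 & m <= pi].
    by rewrite /m !ge_min !lexx !orbT.
  by split; lra.
pose P (z : R * R) := phi (z.1, z.2 + F z.1).
pose A (z : R * R) := d1 phi (z.1, z.2 + F z.1).
pose B (z : R * R) := d2 phi (z.1, z.2 + F z.1).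
have cP : continuous P := continuous_shear cphi cF.
have cA : continuous A := continuous_shear cphi1 cF.
have cB : continuous B := continuous_shear cphi2 cF.
have Pout x y : 0 < x < L -> 0 < y < pi -> ~~ (e < y < pi - e) -> P (x, y) = 0.
  move=> /andP[/ltW x0 /ltW xL] ypi; rewrite negb_and -!leNgt /P/= => /orP[ye|ye].
    rewrite addrC; apply: he1; first by rewrite x0.
    rewrite gtr0_norm; lra.
  have -> : y + F x = F x + pi + (y - pi) by ring.
  apply: he2; first by rewrite x0.
  rewrite ltr0_norm; lra.
have key := @calibration_integral R L e (pi - e) Lam f s s' c c' t r P A B (ltW L0) e0.
have {}key := key _ _ cf ct cr cs' cc' ds dc s0 sL c0 cL cP cA cB.
rewrite integral_strip//; [|exact: pi_ge0|by move=> z; exact: (continuousM (cphi z) (cphi z))|by move=> z; exact: sqr_ge0].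
rewrite (@integral_strip _ (fun z => d1 phi z ^+ 2 + d2 phi z ^+ 2))//;
  [|exact: pi_ge0| |by move=> z; rewrite addr_ge0 ?sqr_ge0]; last first.
  solve_continuous.
set mu2 := (_ \x _)%E.
have cP2 : continuous (fun z => P z ^+ 2) by solve_continuous.
have cAB : continuous (fun z => A z ^+ 2 + B z ^+ 2) by solve_continuous.
have -> : (\int[mu2]_(z in `]0%R, L[ `*` `]0%R, pi[) (phi (z.1, (z.2 + F z.1)%R) ^+ 2)%:E =
    \int[mu2]_(z in `]0%R, L[ `*` `]e, (pi - e)%R[) (P z ^+ 2)%:E)%E.
  rewrite integral_mkcond [RHS]integral_mkcond; apply: eq_integral => -[x y] _.
  rewrite (@patch_rectE _ (fun z => P z ^+ 2)) (@patch_rectE _ (fun z => P z ^+ 2)).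
  have [xL|//] := boolP (0 < x < L); rewrite /=.
  have [yin|yout] := boolP (e < y < pi - e).
    by rewrite ifT//; move: yin => /andP[? ?]; apply/andP; split; lra.
  case: ifPn => // ypi; by rewrite (Pout x y xL ypi yout) expr0n.
rewrite -ge0_integralZl_EFin//; last 3 first.
- exact: measurable_rect.
- by move=> z _; rewrite lee_fin sqr_ge0.
- by apply/measurable_EFinP; exact: continuous_measurable_prod.
apply: (@le_trans _ _ (\int[mu2]_(z in `]0%R, L[ `*` `]e, (pi - e)%R[) (A z ^+ 2 + B z ^+ 2)%:E)%E).
  apply: key => //; [lra|lra| | | ].
  - move=> x y; rewrite addrC; rewrite [_ + d1 _ _]addrC.
    exact: is_derive_shear1 (dF x).
  - move=> x y.
    have dy : is_derive y 1 (fun y => y + F x) 1 by apply: is_derive_eq; rewrite addr0.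
    have := @is_derive1_comp R (fun t => phi (x, t)) (fun y => y + F x) y _ _
      (is_derive_d2 (@dphi2 (x, y + F x))) dy.
    by rewrite mulr1.
  - move=> x xL; split; apply: Pout => //; rewrite ?ltxx ?andbF//; lra.
apply: ge0_subset_integral => //.
- exact: measurable_rect.
- exact: measurable_rect.
- by apply/measurable_EFinP; exact: continuous_measurable_prod.
- by move=> z _; rewrite lee_fin addr_ge0 ?sqr_ge0.
- move=> z [/= z1 z2]; split => //=; move: z2; rewrite !in_itv/= => /andP[? ?].
  by apply/andP; split; lra.
Qed.

(** * Increment bounds, error estimates and construction of the coefficients of the field *)

Lemma increment_ge (R : realType) (h h' : R -> R) (a b m : R) :
  a <= b -> (forall x : R, is_derive x 1 h (h' x)) ->
  (forall x, a <= x <= b -> m <= h' x) -> m * (b - a) <= h b - h a.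
Proof.
move=> ab dh hm.
have [|x xab] := @MVT_segment R h h' a b ab.
  by apply: derivable_within_continuous => x _; case: (dh x).
move=> ->; move: xab; rewrite in_itv/= => xab; apply: ler_wpM2r; first by rewrite subr_ge0.
exact: hm.
Qed.

Lemma increment_abs (R : realType) (h h' : R -> R) (a b m : R) :
  a <= b -> (forall x : R, is_derive x 1 h (h' x)) ->
  (forall x, a <= x <= b -> `|h' x| <= m) -> `|h b - h a| <= m * (b - a).
Proof.
move=> ab dh hm.
have [|x xab] := @MVT_segment R h h' a b ab.
  by apply: derivable_within_continuous => x _; case: (dh x).
move=> ->; move: xab; rewrite in_itv/= => xab; rewrite normrM (ger0_norm (_ : 0 <= b - a)) ?subr_ge0//.
by apply: ler_wpM2r; [rewrite subr_ge0|exact: hm].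
Qed.

Lemma normM_le (R : realType) (x y a b : R) :
  `|x| <= a -> `|y| <= b -> `|x * y| <= a * b.
Proof. by move=> xa yb; rewrite normrM; apply: ler_pM. Qed.

Lemma sqr_le_of_norm (R : realType) (x a : R) : `|x| <= a -> x ^+ 2 <= a ^+ 2.
Proof.
move=> xa; rewrite -real_normK ?num_real//; apply: lerXn2r => //; rewrite ?nnegrE//.
exact: le_trans xa.
Qed.

(** To be used with b = B^2. The squared polynomial is the reciprocal of the coefficient [t] and
    enters through r^2; T^2 <= 400 b^2 <= 2/5 b makes its quadratic part linear in b. *)
Lemma sqr_quadratic_le (R : realType) (T b : R) :
  0 <= b -> b <= 1 / 1000 -> `|T| <= 20 * b ->
  (1 - T + 3 * T ^+ 2) ^+ 2 <= 1 + 50 * b.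
Proof.
move=> b0 b1 hT.
have T2 : T ^+ 2 <= 2 / 5 * b.
  apply: le_trans (sqr_le_of_norm hT) _.
  have : b * b <= 1 / 1000 * b by apply: ler_wpM2r.
  by clear hT; rewrite expr2; lra.
have qn : `|1 - T + 3 * T ^+ 2| <= 1 + 22 * b.
  have T0 := sqr_ge0 T; move: hT; rewrite !ler_norml => /andP[T1 T3].
  by apply/andP; split; move: T0 T2 T1 T3; move: (T ^+ 2) => U *; lra.
apply: le_trans (sqr_le_of_norm qn) _.
have : b * b <= 1 / 1000 * b by apply: ler_wpM2r.
by clear -b0; rewrite expr2; lra.
Qed.

(** The left side is what is lost against 1 + m in the cot-free bracket: 3 T^2 from 1/q - T >= 1 - 3
    T^2, then c^2, then the excess of r^2 over s'^2 / 4. Everything is measured in X = B^3 L: c^2 is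
    of size (B L) X and the cross term s' s c of size B X, so smallness of B L makes the total at
    most 800 X. *)
Lemma corrector_error (R : realType) (L B s s' c T : R) :
  1 <= L -> 0 <= B -> B * L <= 3 / 1250 ->
  `|s| <= 4 * B -> `|s'| <= 4 * B -> `|c| <= 56 * L * B ^+ 2 -> `|T| <= 20 * B ^+ 2 ->
  3 * T ^+ 2 + c ^+ 2 + ((s' - 2 * s * c) ^+ 2 * (1 - T + 3 * T ^+ 2) ^+ 2 - s' ^+ 2) / 4
    <= 800 * B ^+ 3 * L.
Proof.
move=> L1 B0 BL hs hs' hc hT.
have B1 : B <= 3 / 1250 by apply: le_trans BL; rewrite ler_peMr.
set X := B ^+ 3 * L.
have X0 : 0 <= X by rewrite mulr_ge0 ?exprn_ge0//; lra.
have B2 : 0 <= B ^+ 2 by exact: sqr_ge0.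
have B4X : B ^+ 4 <= 3 / 1250 * X.
  have : B ^+ 4 <= B ^+ 4 * L by rewrite ler_peMr// exprn_ge0.
  have : B * X <= 3 / 1250 * X by apply: ler_wpM2r; [exact: X0|exact: B1].
  by rewrite /X; lra.
have T2 : T ^+ 2 <= 400 * B ^+ 4.
  by apply: le_trans (sqr_le_of_norm hT) _; rewrite exprMn -exprM; lra.
have c2 : c ^+ 2 <= 3136 * (3 / 1250 * X).
  apply: le_trans (sqr_le_of_norm hc) _.
  have -> : (56 * L * B ^+ 2) ^+ 2 = 3136 * ((B * L) * X) by rewrite /X; ring.
  by apply: ler_wpM2l; [lra|apply: ler_wpM2r; [exact: X0|exact: BL]].
have sc : `|2 * s * c| <= 448 * X.
  have -> : 448 * X = 8 * B * (56 * L * B ^+ 2) by rewrite /X; ring.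
  apply: normM_le; last exact: hc.
  have -> : 8 * B = 2 * (4 * B) by ring.
  by apply: normM_le; [rewrite ger0_norm|exact: hs].
have XB : X <= 3 / 1250 * B ^+ 2.
  have -> : X = B * L * B ^+ 2 by rewrite /X; ring.
  by apply: ler_wpM2r; [exact: B2|exact: BL].
have Bsq : B ^+ 2 <= 1 / 1000.
  have : B * B <= 3 / 1250 * (3 / 1250).
    by apply: ler_pM; [exact: B0|exact: B0|exact: B1|exact: B1].
  by clear; rewrite expr2; lra.
set q := 1 - T + 3 * T ^+ 2; set w := 2 * s * c in sc *.
have q2 : q ^+ 2 <= 1 + 50 * B ^+ 2 by exact: sqr_quadratic_le.
have sw : (s' - w) ^+ 2 <= s' ^+ 2 + 250 * X.
  have h1 : `|s' * w| <= 4 * B * (448 * X) by apply: normM_le; [exact: hs'|exact: sc].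
  have h2 : w ^+ 2 <= (448 * X) * (448 * X) by rewrite -expr2; exact: sqr_le_of_norm sc.
  have h3 : B * X <= 3 / 1250 * X by apply: ler_wpM2r; [exact: X0|exact: B1].
  have h4 : X * X <= (1 / 1000) * X.
    apply: ler_wpM2r; first exact: X0.
    apply: le_trans XB _.
    have : B * B <= 3 / 1250 * (3 / 1250).
      by apply: ler_pM; [exact: B0|exact: B0|exact: B1|exact: B1].
    by clear; rewrite expr2; lra.
  move: h1; rewrite ler_norml => /andP[h1 _].
  have -> : (s' - w) ^+ 2 = s' ^+ 2 - 2 * (s' * w) + w ^+ 2 by ring.
  by clear -h1 h2 h3 h4 X0; lra.
have s2 : s' ^+ 2 <= 16 * B ^+ 2.
  by apply: le_trans (sqr_le_of_norm hs') _; rewrite exprMn; clear -B2; lra.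
have : (s' - w) ^+ 2 * q ^+ 2 <= (s' ^+ 2 + 250 * X) * (1 + 50 * B ^+ 2).
  by apply: ler_pM; [exact: sqr_ge0|exact: sqr_ge0|exact: sw|exact: q2].
have : s' ^+ 2 * B ^+ 2 <= 16 * B ^+ 4.
  by rewrite -[4%N]/(2 + 2)%N exprD mulrA; apply: ler_wpM2r; [exact: B2|exact: s2].
have XB2 : X * B ^+ 2 <= X * (1 / 1000) by apply: ler_wpM2l; [exact: X0|exact: Bsq].
have -> : 800 * B ^+ 3 * L = 800 * X by rewrite /X; ring.
rewrite mulrDl !mulrDr => h2 h1.
have h4 : s' ^+ 2 * (50 * B ^+ 2) <= 800 * B ^+ 4 by rewrite mulrCA; clear -h2; lra.
have h5 : 250 * X * (50 * B ^+ 2) <= 13 * X.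
  have -> : 250 * X * (50 * B ^+ 2) = 250 * 50 * (X * B ^+ 2) by ring.
  by clear -XB2 X0; lra.
clear -h1 h2 h4 h5 T2 c2 B4X X0 sw; lra.
Qed.

(** [V] is a lower bound for the integral of (F - M)^2 over (0, L), whatever the constant M. The
    levelled second order part [m] is at least 2 V / L^3, and the error of at most 800 B^3 L takes
    away at most V / (2 L^3) because 1600 B^3 L^4 <= V; this leaves the factor 3/2. *)
Lemma exists_corrector (R : realType) (L B V : R) (F f : R -> R) :
  1 <= L -> 0 <= B -> B * L <= 3 / 1250 -> 1600 * B ^+ 3 * L ^+ 4 <= V ->
  continuous f -> (forall x : R, is_derive x 1 F (f x)) ->
  (forall x, 0 <= x <= L -> `|F x| <= B) -> (forall x, 0 <= x <= L -> `|f x| <= B) ->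
  (forall (M : R) (Q : R -> R),
     (forall x : R, is_derive x 1 Q ((F x - M) ^+ 2)) -> V <= Q L - Q 0) ->
  exists s s' c c' t r : R -> R,
    [/\ continuous t, continuous r, continuous s' & continuous c'] /\
    (forall x : R, is_derive x 1 s (s' x)) /\
    (forall x : R, is_derive x 1 c (c' x)) /\
    [/\ s 0 = 0, s L = 0, c 0 = 0 & c L = 0] /\
    forall x, 0 < x < L -> [/\ 0 <= f x * s x + t x - s x ^+ 2 - t x ^+ 2,
     s' x - 2 * s x * c x - 2 * t x * r x = 0 &
     1 + 3 / 2 * (V / L ^+ 3) <= f x * s x + t x + c' x - c x ^+ 2 - r x ^+ 2].
Proof.
move=> L1 B0 BL BV cf dF FB fB hV.
have L0 : 0 < L by lra.
have L0' : 0 <= L by exact: ltW.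
have Ln0 : L != 0 by rewrite gt_eqF.
have cF : continuous F by move=> x; exact: is_derive_continuous (dF x).
have [Phi dPhi] := continuous_primitive cF.
pose M := (Phi L - Phi 0) / L.
have MB : `|M| <= B.
  rewrite /M normrM normfV (ger0_norm L0') ler_pdivrMr//.
  by have := @increment_abs R Phi F 0 L B L0' dPhi FB; rewrite subr0.
(* Chosen so that 2 mu - mu^2 / 4 - mu^2 L^2 / 4, the factor of the variance found in [coef], is at
   least 2 / L^2 when L >= 1. *)
pose mu : R := 2 / L ^+ 2.
have mu0 : 0 <= mu by rewrite divr_ge0// exprn_ge0.
have mu2 : mu <= 2.
  by rewrite /mu ler_pdivrMr ?exprn_gt0// ler_peMr// -[1](expr1n _ 2); apply: lerXn2r; rewrite ?nnegrE.
have muL : mu * L <= 2.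
  have -> : mu * L = 2 / L by rewrite /mu; field.
  by rewrite ler_pdivrMr// ler_peMr.
have FMB x : 0 <= x <= L -> `|F x - M| <= 2 * B.
  by move=> xL; apply: le_trans (ler_normB _ _) _; have := FB x xL; lra.
(* This primitive of F - M vanishes at both ends because [M] is the mean of [F], and so does its
   multiple [s]. *)
pose sg x := Phi x - Phi 0 - M * x.
have dsg (x : R) : is_derive x 1 sg (F x - M).
  by have := dPhi x => ?; apply: is_derive_eq; rewrite /GRing.scale/=; ring.
have sg0 : sg 0 = 0 by rewrite /sg subrr mulr0 subr0.
have sgL : sg L = 0 by rewrite /sg /M; field.
pose s x := - mu * sg x.
pose s' x := - mu * (F x - M).
have ds (x : R) : is_derive x 1 s (s' x).
  by have := dsg x => ?; apply: is_derive_eq; rewrite /s' /GRing.scale/=; ring.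
have cs : continuous s by move=> x; exact: is_derive_continuous (ds x).
have cs' : continuous s' by rewrite /s'; solve_continuous.
have s0 : s 0 = 0 by rewrite /s sg0 mulr0.
have sL : s L = 0 by rewrite /s sgL mulr0.
have s'B x : 0 <= x <= L -> `|s' x| <= 4 * B.
  move=> xL; have -> : 4 * B = 2 * (2 * B) by ring.
  by apply: normM_le; [rewrite normrN ger0_norm|exact: FMB].
have sB x : 0 <= x <= L -> `|s x| <= 4 * B.
  move=> /andP[x0 xL].
  have sgB : `|sg x| <= 2 * B * L.
    have := @increment_abs R sg (fun x => F x - M) 0 x (2 * B) x0 dsg.
    rewrite sg0 !subr0 => h; apply: le_trans (h _) _.
      by move=> z /andP[z0 zx]; apply: FMB; rewrite z0 (le_trans zx).
    by apply: ler_wpM2l => //; rewrite mulr_ge0.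
  have : `|s x| <= mu * (2 * B * L) by apply: normM_le => //; rewrite normrN ger0_norm.
  have -> : mu * (2 * B * L) = mu * L * (2 * B) by ring.
  have : mu * L * (2 * B) <= 2 * (2 * B) by apply: ler_wpM2r => //; rewrite mulr_ge0.
  by clear; move=> h1 h2; apply: le_trans h2 _; apply: le_trans h1 _; lra.
have fsB x : 0 <= x <= L -> `|f x * s x| <= 4 * B ^+ 2.
  move=> xL; have -> : 4 * B ^+ 2 = B * (4 * B) by ring.
  by apply: normM_le; [exact: fB|exact: sB].
(* Second order part of f s + t - r^2 - 1, as t will be close to 1 + f s - s^2 and r to s' / 2. *)
pose e x := 2 * f x * s x - s x ^+ 2 - s' x ^+ 2 / 4.
have ce : continuous e by rewrite /e; solve_continuous.
have eB x : 0 <= x <= L -> `|e x| <= 28 * B ^+ 2.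
  move=> xL; have h1 := fsB x xL.
  have := sqr_le_of_norm (sB x xL); have := sqr_le_of_norm (s'B x xL).
  have := sqr_ge0 (s x); have := sqr_ge0 (s' x); rewrite /e.
  rewrite ![(4 * B) ^+ 2]exprMn -mulrA; move: h1; rewrite !ler_norml => /andP[].
  move: (f x * s x) (s x ^+ 2) (s' x ^+ 2) (B ^+ 2) => u v w b; clear=> ? ? ? ? ? ?.
  by apply/andP; split; lra.
have [E dE] := continuous_primitive ce.
pose m := (E L - E 0) / L.
have mB : `|m| <= 28 * B ^+ 2.
  rewrite /m normrM normfV (ger0_norm L0') ler_pdivrMr//.
  by have := @increment_abs R E e 0 L _ L0' dE eB; rewrite subr0.
(* c' = m - e replaces [e] by its mean [m], and subtracting that mean is what makes [c] vanish at L
   as well. *)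
pose c x := m * x - (E x - E 0).
pose c' x := m - e x.
have dc (x : R) : is_derive x 1 c (c' x).
  by have := dE x => ?; apply: is_derive_eq; rewrite /c' /GRing.scale/=; ring.
have cc' : continuous c' by rewrite /c'; solve_continuous.
have cc : continuous c by move=> x; exact: is_derive_continuous (dc x).
have c0 : c 0 = 0 by rewrite /c subrr mulr0 subr0.
have cL : c L = 0 by rewrite /c /m; field.
have cB x : 0 <= x <= L -> `|c x| <= 56 * L * B ^+ 2.
  move=> /andP[x0 xL].
  have := @increment_abs R c c' 0 x (56 * B ^+ 2) x0 dc.
  rewrite c0 !subr0 => h; apply: le_trans (h _) _.
    move=> z /andP[z0 zx]; apply: le_trans (ler_normB _ _) _.
    by have := eB z; rewrite z0 (le_trans zx xL) => /(_ isT); clear -mB; lra.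
  have -> : 56 * L * B ^+ 2 = 56 * B ^+ 2 * L by ring.
  by apply: ler_wpM2l => //; rewrite mulr_ge0// sqr_ge0.
have mV : 2 * (V / L ^+ 3) <= m.
  have cQ : continuous (fun x => (F x - M) ^+ 2) by solve_continuous.
  have [Q dQ] := continuous_primitive cQ.
  have VQ := hV M Q dQ.
  (* The factor L / 4 uses the zeros of [sg] at both ends; 2 sg(x) / L is the optimal slope
     below. *)
  have sgQ x : 0 <= x <= L -> sg x ^+ 2 <= L / 4 * (Q L - Q 0).
    move=> /andP[x0 xL].
    (* int_u^v (sg' - a)^2 >= 0, applied on (0, x) and (x, L) with opposite a. *)
    have mono a u v : u <= v ->
        0 <= Q v - Q u - 2 * a * (sg v - sg u) + a ^+ 2 * (v - u).
      move=> uv; pose h x := Q x - 2 * a * sg x + a ^+ 2 * x.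
      have dh (z : R) : is_derive z 1 h ((F z - M - a) ^+ 2).
        by have := dQ z; have := dsg z => ? ?; apply: is_derive_eq; rewrite /GRing.scale/=; ring.
      have := @increment_ge R h _ u v 0 uv dh (fun z _ => sqr_ge0 _).
      by rewrite mul0r /h; lra.
    have := mono (2 * sg x / L) 0 x x0; have := mono (- (2 * sg x / L)) x L xL.
    rewrite sg0 sgL !subr0 sub0r => h1 h2.
    have : 0 <= Q L - Q 0 - 4 * sg x ^+ 2 / L.
      rewrite (_ : Q L - Q 0 - 4 * sg x ^+ 2 / L = (Q L - Q x - 2 * - (2 * sg x / L) * - sg x +
        (- (2 * sg x / L)) ^+ 2 * (L - x)) + (Q x - Q 0 - 2 * (2 * sg x / L) * (sg x - 0) +
        (2 * sg x / L) ^+ 2 * x)); last by field.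
      by rewrite subr0; exact: addr_ge0.
    move=> h3; have : 0 <= (Q L - Q 0 - 4 * sg x ^+ 2 / L) * L by exact: mulr_ge0.
    have -> : (Q L - Q 0 - 4 * sg x ^+ 2 / L) * L = (Q L - Q 0) * L - 4 * sg x ^+ 2 by field.
    by clear; lra.
  (* Integrates 2 f s by parts against s' = - mu (F - M). *)
  pose h x := E x - 2 * (F x - M) * s x - (2 * mu - mu ^+ 2 / 4) * Q x.
  have dh (z : R) : is_derive z 1 h (- s z ^+ 2).
    have := dE z; have := dF z; have := ds z; have := dQ z => ? ? ? ?.
    by apply: is_derive_eq; rewrite /e /s' /GRing.scale/=; field.
  have hs z : 0 <= z <= L -> - (mu ^+ 2 * (L / 4 * (Q L - Q 0))) <= - s z ^+ 2.
    move=> zL; rewrite lerN2 /s exprMn sqrrN.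
    by apply: ler_wpM2l; [exact: sqr_ge0|exact: sgQ].
  have := @increment_ge R h _ 0 L _ L0' dh hs.
  rewrite /h s0 sL !mulr0 !subr0 => hE.
  have Q0 : 0 <= Q L - Q 0.
    by have := @increment_ge R Q _ 0 L 0 L0' dQ (fun z _ => sqr_ge0 _); rewrite mul0r.
  have hE2 : (2 * mu - mu ^+ 2 / 4 - mu ^+ 2 * L ^+ 2 / 4) * (Q L - Q 0) <= E L - E 0 by lra.
  have coef : 2 / L ^+ 2 <= 2 * mu - mu ^+ 2 / 4 - mu ^+ 2 * L ^+ 2 / 4.
    rewrite -subr_ge0; have -> : 2 * mu - mu ^+ 2 / 4 - mu ^+ 2 * L ^+ 2 / 4 - 2 / L ^+ 2 =
      (L ^+ 2 - 1) / L ^+ 4 by rewrite /mu; field.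
    rewrite divr_ge0 ?exprn_ge0// subr_ge0 -[1](expr1n _ 2).
    by apply: lerXn2r; rewrite ?nnegrE.
  have V0 : 2 / L ^+ 2 * V <= E L - E 0.
    apply: le_trans hE2; apply: le_trans (_ : 2 / L ^+ 2 * (Q L - Q 0) <= _).
      by apply: ler_wpM2l; [exact: mu0|exact: VQ].
    by apply: ler_wpM2r.
  have -> : 2 * (V / L ^+ 3) = 2 / L ^+ 2 * V / L by field.
  by rewrite /m ler_pM2r ?invr_gt0.
pose T x := f x * s x - s x ^+ 2.
(* Taking t = 1 / q makes T + t - t^2 = T^2 (1 + O(T)) / q^2 nonnegative for small T. *)
pose q x := 1 - T x + 3 * T x ^+ 2.
have q0 x : 0 < q x.
  have := sqr_ge0 (T x - 1 / 6); rewrite /q; move: (T x) => T'.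
  by rewrite sqrrB !expr2; lra.
have cT : continuous T by rewrite /T; solve_continuous.
have cq : continuous q by rewrite /q; solve_continuous.
(* The last witness solves s' - 2 s c - 2 t r = 0 for r, with t = 1 / q. *)
exists s, s', c, c', (fun x => (q x)^-1), (fun x => (s' x - 2 * s x * c x) * q x / 2).
split; first split => //.
- by move=> x; apply: continuousV; [rewrite gt_eqF|exact: cq].
- by solve_continuous.
split=> //; split=> //; split; first by split.
move=> x /andP[/ltW x0 /ltW xL].
have xx : 0 <= x <= L by rewrite x0.
have TB : `|T x| <= 20 * B ^+ 2.
  have h1 := fsB x xx.
  have := sqr_le_of_norm (sB x xx); have := sqr_ge0 (s x); rewrite /T [(4 * B) ^+ 2]exprMn.
  move: h1; rewrite !ler_norml => /andP[].
  move: (f x * s x) (s x ^+ 2) (B ^+ 2) => u v b; clear=> ? ? ? ?.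
  by apply/andP; split; lra.
have err := corrector_error L1 B0 BL (sB x xx) (s'B x xx) (cB x xx) TB.
have qx := q0 x; have qn : q x != 0 by rewrite gt_eqF.
split.
- have -> : f x * s x + (q x)^-1 - s x ^+ 2 - (q x)^-1 ^+ 2 =
    T x ^+ 2 * (1 + 7 * T x - 6 * T x ^+ 2 + 9 * T x ^+ 3) / q x ^+ 2.
    have -> : f x * s x + (q x)^-1 - s x ^+ 2 - (q x)^-1 ^+ 2 = T x + (q x)^-1 - (q x)^-1 ^+ 2.
      by rewrite /T; ring.
    by move: qn; rewrite /q => qn; field.
  have Tb : `|T x| <= 1 / 50.
    apply: le_trans TB _; have : B * B <= 3 / 1250 * (3 / 1250).
      have B1 : B <= 3 / 1250 by apply: le_trans BL; rewrite ler_peMr.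
      by apply: ler_pM; [exact: B0|exact: B0|exact: B1|exact: B1].
    by clear; rewrite expr2; lra.
  apply: divr_ge0; last exact: sqr_ge0.
  apply: mulr_ge0; first exact: sqr_ge0.
  have T2 : T x ^+ 2 <= 1 / 50.
    by apply: le_trans (sqr_le_of_norm Tb) _; clear; lra.
  have T3 : `|T x ^+ 2 * T x| <= 1 / 50 * (1 / 50).
    by apply: normM_le; [rewrite ger0_norm// sqr_ge0|exact: Tb].
  move: Tb T3 T2; rewrite -exprSr !ler_norml => /andP[+ _] /andP[+ _].
  by move: (T x) (T x ^+ 2) (T x ^+ 3) => a b d; clear; lra.
- by field.
have -> : f x * s x + (q x)^-1 + c' x - c x ^+ 2 -
    ((s' x - 2 * s x * c x) * q x / 2) ^+ 2 =
  m + ((q x)^-1 - T x) - (c x ^+ 2 + ((s' x - 2 * s x * c x) ^+ 2 * q x ^+ 2 - s' x ^+ 2) / 4).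
  by rewrite /c' /e /T; field.
(* 1/q lies above its tangent 2 - q at q = 1, and 2 - q = 1 + T - 3 T^2. *)
have qT : 1 - 3 * T x ^+ 2 <= (q x)^-1 - T x.
  have : 2 - q x <= (q x)^-1.
    rewrite -subr_ge0; have -> : (q x)^-1 - (2 - q x) = (q x - 1) ^+ 2 / q x by field.
    by rewrite divr_ge0 ?sqr_ge0// ltW.
  by rewrite {1}/q; move: (T x) (T x ^+ 2) => a b; clear; lra.
have V3 : 1600 * (B ^+ 3 * L) <= V / L ^+ 3.
  rewrite ler_pdivlMr ?exprn_gt0//.
  have -> : 1600 * (B ^+ 3 * L) * L ^+ 3 = 1600 * B ^+ 3 * L ^+ 4 by ring.
  exact: BV.
move: err qT V3 mV; rewrite -/(q x).
have -> : 800 * B ^+ 3 * L = 800 * (B ^+ 3 * L) by ring.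
clear; generalize (B ^+ 3 * L) (V / L ^+ 3) (T x ^+ 2) ((q x)^-1 - T x) (c x ^+ 2) m.
move: (s' x) (s x) (c x) (q x) => s'x sx cx qx; clear=> *; lra.
Qed.

(** * The boundary profile as a finite sum over cells *)

Section cell_sum.
Context {R : realType}.
Variables (l : R) (g : R -> R) (omega : int -> R).
Hypothesis l0 : 0 < l.
Hypothesis gout : forall x, ~~ (0 < x < l) -> g x = 0.

(** Replaces [G] over (0, N l), where both agree. The index set is fixed and finite, so derivatives
    and continuity are obtained termwise on the whole line. *)
Definition cell_sum (N : nat) (x : R) : R :=
  \sum_(k < N) omega k%:Z * g (x - k%:R * l).

Lemma G_cell_sum (N : nat) (x : R) : 0 < x < N%:R * l -> G l g omega x = cell_sum N x.
Proof.
move=> /andP[x0 xN]; rewrite /G /cell_sum.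
pose h (k : nat) := omega k%:Z * g (x - k%:R * l).
rewrite (_ : \sum_(k < N) _ = \sum_(k < N) h k)// fsbig_ord.
have <- : \sum_(k \in Posz @` `I_N) omega k * g (x - k%:~R * l) = \sum_(k \in `I_N) h k.
  by apply: fsbig_image => a b _ _ [].
apply/esym; apply: fsbig_widen => // k [_ kN] /=.
rewrite gout ?mulr0//; apply/negP => /andP[h1 h2]; apply: kN.
case: k h1 h2 => k h1 h2.
  exists k => //=; rewrite -(ltr_nat R) -(ltr_pM2r l0).
  by apply: lt_trans xN; rewrite -subr_gt0.
(* [Negz k] is -(k + 1), so the argument of g is at least x + l and misses the support. *)
suff : l <= x - (Negz k)%:~R * l by rewrite leNgt h2.
rewrite NegzE mulrNz mulNr opprK -pmulrn.
have : l <= k.+1%:R * l by rewrite ler_peMl ?ler1n// ltW.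
by lra.
Qed.

(** Closed cells are allowed because g also vanishes at 0 and l. *)
Lemma cell_vanish (j k : nat) (x : R) : j != k ->
  j%:R * l <= x <= j.+1%:R * l -> g (x - k%:R * l) = 0.
Proof.
move=> jk /andP[x1 x2]; apply: gout; apply/negP => /andP[h1 h2].
move: jk; rewrite neq_ltn => /orP[jk|jk].
  have : j.+1%:R * l <= k%:R * l by rewrite ler_pM2r// ler_nat.
  by lra.
have : k.+1%:R * l <= j%:R * l by rewrite ler_pM2r// ler_nat.
by rewrite -addn1 natrD mulrDl; lra.
Qed.

Lemma cell_sum_cell (N j : nat) (x : R) : (j < N)%N ->
  j%:R * l <= x <= j.+1%:R * l ->
  cell_sum N x = omega j%:Z * g (x - j%:R * l).
Proof.
move=> jN xj; rewrite /cell_sum (bigD1 (Ordinal jN))//= big1 ?addr0// => i ij.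
rewrite (@cell_vanish j) ?mulr0//; apply: contra ij => /eqP ji.
by apply/eqP/val_inj.
Qed.

Lemma is_derive_cell_sum (N : nat) (g' : R -> R) :
  (forall x : R, is_derive x 1 g (g' x)) ->
  forall x : R, is_derive x 1 (cell_sum N) (\sum_(k < N) omega k%:Z * g' (x - k%:R * l)).
Proof.
move=> dg x.
have dk (k : 'I_N) : is_derive x 1 (fun x => omega k%:Z * g (x - k%:R * l))
    (omega k%:Z * g' (x - k%:R * l)).
  have d1 : is_derive x 1 (fun x : R => x - k%:R * l) 1.
    by apply: is_derive_eq; rewrite subr0.
  have := @is_derive1_comp R g (fun x => x - k%:R * l) x _ _ (dg _) d1.
  rewrite mulr1 => ?.
  by apply: is_derive_eq; rewrite /GRing.scale/=; ring.
have -> : cell_sum N = \sum_(k < N) (fun x => omega k%:Z * g (x - k%:R * l)).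
  by apply/funext => z; rewrite /cell_sum fct_sumE.
exact: is_derive_sum.
Qed.

Lemma continuous_cell_sum (N : nat) (h : R -> R) : continuous h ->
  continuous (fun x => \sum_(k < N) omega k%:Z * h (x - k%:R * l)).
Proof.
move=> ch; elim: N => [|n IHn] x.
  have -> : (fun x => \sum_(k < 0) omega k%:Z * h (x - k%:R * l)) = fun=> 0.
    by apply/funext => y; rewrite big_ord0.
  exact: cvg_cst.
have -> : (fun x => \sum_(k < n.+1) omega k%:Z * h (x - k%:R * l)) =
    fun x => \sum_(k < n) omega k%:Z * h (x - k%:R * l) + omega n%:Z * h (x - n%:R * l).
  by apply/funext => y; rewrite big_ord_recr.
have cn : continuous (fun x => h (x - n%:R * l)).
  move=> y; apply: (@continuous_comp _ _ _ (fun y => y - n%:R * l) h); last exact: ch.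
  by apply: (@continuousB _ _ _ id (fun=> n%:R * l)); [exact: cvg_id|exact: cvg_cst].
by move: x; solve_continuous.
Qed.

Lemma omega_norm_ge0 (N : nat) : 0 <= omega_norm omega N.
Proof. exact: sqrtr_ge0. Qed.

Lemma omega_norm_sqr (N : nat) :
  omega_norm omega N ^+ 2 = \sum_(k < N) omega k%:Z ^+ 2.
Proof. by rewrite sqr_sqrtr// sumr_ge0// => k _; exact: sqr_ge0. Qed.

Lemma omega_le_norm (N : nat) (k : 'I_N) : `|omega k%:Z| <= omega_norm omega N.
Proof.
rewrite -sqrtr_sqr ler_wsqrtr// (bigD1 k)//= lerDl sumr_ge0// => i _.
exact: sqr_ge0.
Qed.

(** Stated for a general [h] so as to serve both g and its derivative, that is, both F and f. *)
Lemma cell_sum_norm (N : nat) (h : R -> R) (x : R) : (forall x, `|h x| <= 1) ->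
  `|\sum_(k < N) omega k%:Z * h (x - k%:R * l)| <= N%:R * omega_norm omega N.
Proof.
move=> h1; apply: le_trans (ler_norm_sum _ _ _) _.
apply: (@le_trans _ _ (\sum_(k < N) omega_norm omega N)).
  apply: ler_sum => k _; rewrite normrM -[leRHS]mulr1.
  by apply: ler_pM => //; exact: omega_le_norm.
by rewrite sumr_const card_ord mulr_natl.
Qed.

(** On cell j, kappa G - M = w (g - gbar) + b with w = kappa omega_j and b = w gbar - M. The cross
    term integrates to zero since g - gbar has mean zero, b^2 is dropped, and the increments of [Q]
    over the cells telescope. *)
Lemma cell_variance (N : nat) (kappa M : R) (Q Q2 Q1 : R -> R) (gbar : R) :
  (forall x : R, is_derive x 1 Q ((kappa * cell_sum N x - M) ^+ 2)) ->
  (forall x : R, is_derive x 1 Q2 ((g x - gbar) ^+ 2)) ->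
  (forall x : R, is_derive x 1 Q1 (g x - gbar)) ->
  Q1 l = Q1 0 ->
  kappa ^+ 2 * omega_norm omega N ^+ 2 * (Q2 l - Q2 0) <= Q (N%:R * l) - Q 0.
Proof.
move=> dQ dQ2 dQ1 mean0.
rewrite omega_norm_sqr.
have cell (j : nat) : (j < N)%N ->
   kappa ^+ 2 * omega j%:Z ^+ 2 * (Q2 l - Q2 0) <= Q (j.+1%:R * l) - Q (j%:R * l).
  move=> jN; set w := kappa * omega j%:Z; set b := w * gbar - M.
  pose h x := Q x - w ^+ 2 * Q2 (x - j%:R * l) - 2 * w * b * Q1 (x - j%:R * l).
  have lj : j%:R * l <= j.+1%:R * l by rewrite ler_pM2r// ler_nat.
  have sh (x : R) : is_derive x 1 (fun x : R => x - j%:R * l) 1.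
    by apply: is_derive_eq; rewrite subr0.
  have dh (x : R) : is_derive x 1 h ((kappa * cell_sum N x - M) ^+ 2 -
      w ^+ 2 * (g (x - j%:R * l) - gbar) ^+ 2 - 2 * w * b * (g (x - j%:R * l) - gbar)).
    have := @is_derive1_comp R Q2 (fun x => x - j%:R * l) x _ _ (dQ2 _) (sh x).
    have := @is_derive1_comp R Q1 (fun x => x - j%:R * l) x _ _ (dQ1 _) (sh x).
    have := dQ x; rewrite !mulr1 => ? ? ?.
    by apply: is_derive_eq; rewrite /GRing.scale/=; ring.
  have inc : 0 <= h (j.+1%:R * l) - h (j%:R * l).
    rewrite -(mul0r (j.+1%:R * l - j%:R * l)); apply: increment_ge lj dh _ => x xj.
     rewrite (cell_sum_cell jN xj).
    have -> : (kappa * (omega j%:Z * g (x - j%:R * l)) - M) ^+ 2 -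
        w ^+ 2 * (g (x - j%:R * l) - gbar) ^+ 2 - 2 * w * b * (g (x - j%:R * l) - gbar) =
        b ^+ 2 by rewrite /b /w; ring.
    exact: sqr_ge0.
  have e0 : j%:R * l - j%:R * l = 0 by exact: subrr.
  have e1 : j.+1%:R * l - j%:R * l = l by rewrite -addn1 natrD; ring.
  move: inc; rewrite /h e0 e1 mean0.
  have -> : kappa ^+ 2 * omega j%:Z ^+ 2 = w ^+ 2 by rewrite /w; ring.
  by lra.
rewrite mulr_sumr mulr_suml.
apply: le_trans (ler_sum _ (fun (j : 'I_N) _ => cell j (ltn_ord j))) _.
rewrite -(big_mkord xpredT (fun j => Q (j.+1%:R * l) - Q (j%:R * l))).
by rewrite telescope_sumr// mul0r.
Qed.
End cell_sum.

(** * Passage from test functions to the form domain *)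

Section form_limit.
Context d (T : measurableType d) (R : realType).
Variables (mu : {measure set T -> \bar R}) (D : set T).
Hypothesis mD : measurable D.

Lemma measurable_sqr_EFin (k : T -> R) :
  measurable_fun D k -> measurable_fun D (fun z => (k z ^+ 2)%:E).
Proof. by move=> mk; apply/measurable_EFinP; exact: measurable_funX. Qed.

(** Young's inequality: pointwise, right side minus left side is (th y - (x - y))^2 / th. The factor
    1 + th can be taken arbitrarily close to 1. *)
Lemma integral_sqr_triangle (x y : T -> R) (th : R) :
  measurable_fun D x -> measurable_fun D y -> 0 < th ->
  (\int[mu]_(z in D) (x z ^+ 2)%:E <=
   (1 + th)%:E * \int[mu]_(z in D) (y z ^+ 2)%:E +
   (1 + th^-1)%:E * \int[mu]_(z in D) ((x z - y z) ^+ 2)%:E)%E.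
Proof.
move=> mx my th0.
have mxy : measurable_fun D (fun z => x z - y z) by exact: measurable_funB.
have th1 : 0 <= th^-1 by rewrite invr_ge0 ltW.
have sq0 (k : T -> R) z : D z -> (0 <= (k z ^+ 2)%:E)%E.
  by rewrite lee_fin sqr_ge0.
have y0 := measurable_sqr_EFin my; have xy0 := measurable_sqr_EFin mxy.
rewrite -ge0_integralZl_EFin//; last 2 first.
- by move=> z; exact: sq0.
- by rewrite addr_ge0// ltW.
rewrite -ge0_integralZl_EFin//; last 2 first.
- by move=> z; exact: (sq0 (fun z => x z - y z)).
- by rewrite addr_ge0.
rewrite -ge0_integralD//; last 4 first.
- by move=> z Dz; rewrite mule_ge0// ?lee_fin ?sqr_ge0// addr_ge0// ltW.
- exact: measurable_funeM.
- by move=> z Dz; rewrite mule_ge0// ?lee_fin ?sqr_ge0// addr_ge0.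
- exact: measurable_funeM.
apply: ge0_le_integral => //.
- by move=> z; exact: sq0.
- exact: measurable_sqr_EFin.
- by apply: emeasurable_funD; exact: measurable_funeM.
move=> z Dz; rewrite -!EFinM -EFinD lee_fin -subr_ge0.
have -> : (1 + th) * y z ^+ 2 + (1 + th^-1) * (x z - y z) ^+ 2 - x z ^+ 2 =
    (th * y z - (x z - y z)) ^+ 2 / th by field; rewrite gt_eqF.
by rewrite divr_ge0 ?sqr_ge0// ltW.
Qed.

(** The triangle inequality above is applied to the function and to both derivatives at an index
    where all three squared errors are at most [e]; then e tends to 0 with [th] fixed, and finally
    th tends to 0. *)
Lemma form_inequality_limit (Lam : R) (u p1 p2 : T -> R) (phi a b : nat -> T -> R) :
  0 <= Lam ->
  measurable_fun D u -> measurable_fun D p1 -> measurable_fun D p2 ->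
  (forall n, measurable_fun D (phi n)) -> (forall n, measurable_fun D (a n)) ->
  (forall n, measurable_fun D (b n)) ->
  (fun n => \int[mu]_(z in D) ((phi n z - u z) ^+ 2)%:E)%E @ \oo --> 0%E ->
  (fun n => \int[mu]_(z in D) ((a n z - p1 z) ^+ 2)%:E)%E @ \oo --> 0%E ->
  (fun n => \int[mu]_(z in D) ((b n z - p2 z) ^+ 2)%:E)%E @ \oo --> 0%E ->
  (forall n, Lam%:E * \int[mu]_(z in D) (phi n z ^+ 2)%:E <=
     \int[mu]_(z in D) (a n z ^+ 2 + b n z ^+ 2)%:E)%E ->
  (\int[mu]_(z in D) (p1 z ^+ 2)%:E < +oo)%E ->
  (\int[mu]_(z in D) (p2 z ^+ 2)%:E < +oo)%E ->
  (Lam%:E * \int[mu]_(z in D) (u z ^+ 2)%:E <=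
     \int[mu]_(z in D) (p1 z ^+ 2)%:E + \int[mu]_(z in D) (p2 z ^+ 2)%:E)%E.
Proof.
move=> Lam0 mu_ mp1 mp2 mphi ma mb cu c1 c2 H fp1 fp2.
have int0 (k : T -> R) : (0 <= \int[mu]_(z in D) (k z ^+ 2)%:E)%E.
  by apply: integral_ge0 => z _; rewrite lee_fin sqr_ge0.
set P1 := (\int[mu]_(z in D) (p1 z ^+ 2)%:E)%E in fp1 *.
set P2 := (\int[mu]_(z in D) (p2 z ^+ 2)%:E)%E in fp2 *.
have [r1 r10 P1E] : exists2 r, 0 <= r & P1 = r%:E.
  have P1f : P1 \is a fin_num by rewrite ge0_fin_numE ?int0.
  by exists (fine P1); [apply: fine_ge0; exact: int0|rewrite fineK].
have [r2 r20 P2E] : exists2 r, 0 <= r & P2 = r%:E.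
  have P2f : P2 \is a fin_num by rewrite ge0_fin_numE ?int0.
  by exists (fine P2); [apply: fine_ge0; exact: int0|rewrite fineK].
have near_le (k : nat -> T -> R) (e : R) : 0 < e ->
    (fun n => \int[mu]_(z in D) (k n z ^+ 2)%:E)%E @ \oo --> 0%E ->
    \forall n \near \oo, (\int[mu]_(z in D) (k n z ^+ 2)%:E <= e%:E)%E.
  move=> e0 ck; have lt : \forall y \near 0%E, (y < e%:E)%E by apply: open_ereal_lt'; rewrite lte_fin.
  have near_lt := ck _ lt; near=> n; apply: ltW.
  by near: n; exact: near_lt.
have main (th e : R) : 0 < th -> 0 < e ->
    (Lam%:E * \int[mu]_(z in D) (u z ^+ 2)%:E <=
     ((1 + th) ^+ 2 * (r1 + r2) + (Lam + 2 * (1 + th)) * (1 + th^-1) * e)%:E)%E.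
  move=> th0 e0.
  have th1 : 0 <= th^-1 by rewrite invr_ge0 ltW.
  have [n [nu n1 n2]] : exists n, [/\ (\int[mu]_(z in D) ((phi n z - u z) ^+ 2)%:E <= e%:E)%E,
      (\int[mu]_(z in D) ((a n z - p1 z) ^+ 2)%:E <= e%:E)%E &
      (\int[mu]_(z in D) ((b n z - p2 z) ^+ 2)%:E <= e%:E)%E].
    near \oo => n; exists n; split; near: n.
    - exact: (near_le (fun n z => phi n z - u z)).
    - exact: (near_le (fun n z => a n z - p1 z)).
    - exact: (near_le (fun n z => b n z - p2 z)).
  have symm (x y : T -> R) : (\int[mu]_(z in D) ((x z - y z) ^+ 2)%:E =
      \int[mu]_(z in D) ((y z - x z) ^+ 2)%:E)%E.
    by apply: eq_integral => z _; congr _%:E; rewrite -sqrrN opprB.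
  have tha : 0 <= 1 + th by rewrite addr_ge0// ltW.
  have thb : 0 <= 1 + th^-1 by rewrite addr_ge0.
  have iu := integral_sqr_triangle mu_ (mphi n) th0.
  have ia := integral_sqr_triangle (ma n) mp1 th0.
  have ib := integral_sqr_triangle (mb n) mp2 th0.
  rewrite symm in iu.
  have {}ia : (\int[mu]_(z in D) (a n z ^+ 2)%:E <= ((1 + th) * r1 + (1 + th^-1) * e)%:E)%E.
    apply: le_trans ia _; rewrite -/P1 P1E [leRHS]EFinD EFinM; apply: leeD => //.
    by rewrite [leRHS]EFinM; apply: lee_wpmul2l; rewrite ?lee_fin.
  have {}ib : (\int[mu]_(z in D) (b n z ^+ 2)%:E <= ((1 + th) * r2 + (1 + th^-1) * e)%:E)%E.
    apply: le_trans ib _; rewrite -/P2 P2E [leRHS]EFinD EFinM; apply: leeD => //.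
    by rewrite [leRHS]EFinM; apply: lee_wpmul2l; rewrite ?lee_fin.
  have Hn : (Lam%:E * \int[mu]_(z in D) (phi n z ^+ 2)%:E <=
      ((1 + th) * r1 + (1 + th^-1) * e + ((1 + th) * r2 + (1 + th^-1) * e))%:E)%E.
    apply: le_trans (H n) _.
    under eq_integral do rewrite EFinD.
    rewrite ge0_integralD//.
    - by rewrite EFinD; exact: leeD.
    - by move=> z _; rewrite lee_fin sqr_ge0.
    - exact: measurable_sqr_EFin.
    - by move=> z _; rewrite lee_fin sqr_ge0.
    - exact: measurable_sqr_EFin.
  apply: le_trans (lee_wpmul2l _ iu) _; first by rewrite lee_fin.
  rewrite ge0_muleDr ?mule_ge0 ?lee_fin//.
  rewrite muleCA (muleA Lam%:E (1 + th^-1)%:E).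
  have -> : (1 + th) ^+ 2 * (r1 + r2) + (Lam + 2 * (1 + th)) * (1 + th^-1) * e =
    (1 + th) * ((1 + th) * r1 + (1 + th^-1) * e + ((1 + th) * r2 + (1 + th^-1) * e)) +
    Lam * (1 + th^-1) * e by ring.
  rewrite [leRHS]EFinD; apply: leeD; rewrite [leRHS]EFinM.
    by apply: lee_wpmul2l; rewrite ?lee_fin.
  by rewrite (EFinM Lam); apply: lee_wpmul2l; rewrite -?EFinM ?lee_fin// mulr_ge0.
(* The case th = e = 1 of [main] shows that the left side is finite, so the rest is real
   arithmetic. *)
have [U UE] : exists U, (Lam%:E * \int[mu]_(z in D) (u z ^+ 2)%:E = U%:E)%E.
  have fU : (Lam%:E * \int[mu]_(z in D) (u z ^+ 2)%:E)%E \is a fin_num.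
    rewrite ge0_fin_numE; last by rewrite mule_ge0 ?lee_fin.
    by apply: le_lt_trans (main 1 1 _ _) _ => //; rewrite ltry.
  by exists (fine (Lam%:E * \int[mu]_(z in D) (u z ^+ 2)%:E)%E); rewrite fineK.
rewrite P1E P2E UE -EFinD lee_fin.
have main1 (th : R) : 0 < th -> U <= (1 + th) ^+ 2 * (r1 + r2).
  move=> th0; apply/ler_addgt0Pr => e e0.
  pose C := (Lam + 2 * (1 + th)) * (1 + th^-1).
  have th1 : 0 < th^-1 by rewrite invr_gt0.
  have C0 : 0 < C by apply: mulr_gt0; lra.
  have := main th (e / C) th0 (divr_gt0 e0 C0).
  by rewrite UE lee_fin -/C mulrCA divff ?gt_eqF// mulr1.
apply/ler_addgt0Pr => e e0.
pose S := r1 + r2.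
have S0 : 0 <= S by rewrite addr_ge0.
(* For th <= 1, (1 + th)^2 S exceeds S by at most 3 th S <= e; the added 1 keeps the denominator
   positive when S = 0. *)
pose th := Num.min 1 (e / (3 * S + 1)).
have th0 : 0 < th by rewrite lt_min ltr01 divr_gt0//; lra.
have thS : th * (3 * S + 1) <= e by rewrite -ler_pdivlMr ?ge_min ?lexx ?orbT//; lra.
have th1 : th <= 1 by rewrite ge_min lexx.
apply: le_trans (main1 th th0) _; rewrite -/S.
have : th * th * S <= th * S by apply: ler_wpM2r => //; rewrite ger_pMl.
rewrite sqrrD; move: thS; lra.
Unshelve. all: by end_near. Qed.

End form_limit.

(** * Elementary facts about the profile g *)

Lemma integral_cc_is_derive (R : realType) (f P : R -> R) (a b : R) :
  a <= b -> continuous f ->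
  (forall x : R, a <= x <= b -> is_derive x 1 P (f x)) ->
  (\int[lebesgue_measure]_(x in `[a, b]) (f x)%:E = (P b - P a)%:E)%E.
Proof.
move=> ab cf dP.
have mf (D : set R) : measurable_fun D (fun x => (f x)%:E).
  by apply/measurable_EFinP; apply: measurable_funTS; exact: continuous_measurable_fun.
rewrite -(integral_oo_is_derive ab cf dP).
by rewrite integral_itv_obnd_cbnd// integral_itv_bndo_bndc.
Qed.

(** The supremum bounds the values only if the set is bounded above; compactness of [0, l] provides
    this. *)
Lemma Cnorm_ub (R : realType) (l : R) (h : R -> R) (x : R) :
  continuous h -> 0 <= x <= l -> `|h x| <= Cnorm l h.
Proof.
move=> ch xl; apply: ub_le_sup; last by exists x => //=; rewrite in_itv.
have [M [_ hM]] : bounded_set (h @` `[0, l]).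
  apply: compact_bounded; apply: continuous_compact; last exact: segment_compact.
  exact: continuous_subspaceT.
(* [bounded_set] gives a bound by every number strictly above [M], hence by M + 1. *)
exists (M + 1) => _ [y yl <-]; apply: (hM (M + 1)); first by rewrite ltrDl.
by exists y.
Qed.

Section profile.
Context {R : realType}.
Variables (l : R) (g : R -> R).
Hypothesis hg : C20 l g.

Lemma C20_out x : ~~ (0 < x < l) -> g x = 0.
Proof.
case: hg => _ _ sub; apply: contraNeq => gx.
suff : `]0, l[%classic x by rewrite /= in_itv.
by apply: sub; apply: subset_closure.
Qed.

Lemma C20_is_derive (x : R) : is_derive x 1 g (derive1 g x).
Proof.
case: hg => -[dg _ _] _ _; apply: DeriveDef; first exact: dg.
by rewrite derive1E.
Qed.

Lemma C20_continuous : continuous g.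
Proof. by move=> x; exact: is_derive_continuous (C20_is_derive x). Qed.

Lemma C20_derive_continuous : continuous (derive1 g).
Proof.
case: hg => -[_ dg' _] _ _ x.
by apply/differentiable_continuous/derivable1_diffP; exact: dg'.
Qed.

Lemma C20_derive_out x : ~~ (0 <= x <= l) -> derive1 g x = 0.
Proof.
move=> xl; have z0 : is_derive x 1 g 0.
  apply: (@near_eq_is_derive _ _ _ (fun=> 0)) => //.
  have : nbhs x (~` `[0, l]%classic).
    apply: open_nbhs_nbhs; split; first exact/closed_openC/itv_closed.
    by rewrite /= in_itv/=; apply/negP.
  apply: filterS => y /=; rewrite in_itv/= => /negP yl.
  rewrite C20_out//; apply: contra yl => /andP[/ltW -> /ltW ->] //.
by rewrite derive1E derive_val.
Qed.
End profile.

(** * From the form inequality to a bound on the eigenvalue *)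

(** The identity says that the Dirichlet integral of u is lam times the integral of u^2. The latter
    is positive, as u is not almost everywhere zero, and can be cancelled from the inequality. *)
Lemma ratio_le_of_integral_identity d (T : measurableType d) (R : realType)
    (mu : {measure set T -> \bar R}) (D : set T) (u p1 p2 : T -> R) (lam Lam : R) :
  measurable D ->
  measurable_fun D u -> measurable_fun D p1 -> measurable_fun D p2 ->
  mu.-integrable D (fun z => (u z ^+ 2)%:E) ->
  mu.-integrable D (fun z => (p1 z ^+ 2)%:E) ->
  mu.-integrable D (fun z => (p2 z ^+ 2)%:E) ->
  ~ {ae mu, forall z, D z -> u z = 0} ->
  \int[mu]_(z in D) (p1 z * p1 z + p2 z * p2 z) = \int[mu]_(z in D) (lam * u z * u z) ->
  (Lam%:E * \int[mu]_(z in D) (u z ^+ 2)%:E <=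
     \int[mu]_(z in D) (p1 z ^+ 2)%:E + \int[mu]_(z in D) (p2 z ^+ 2)%:E)%E ->
  Lam <= lam.
Proof.
move=> mD mu_ mp1 mp2 iu i1 i2 unz eqn le.
have ue : \int[mu]_(z in D) (lam * u z * u z) = lam * \int[mu]_(z in D) (u z ^+ 2).
  rewrite -RintegralZl//; apply: eq_Rintegral => z _.
  by rewrite expr2 mulrA.
have pe : \int[mu]_(z in D) (p1 z * p1 z + p2 z * p2 z) =
    \int[mu]_(z in D) (p1 z ^+ 2) + \int[mu]_(z in D) (p2 z ^+ 2).
  by rewrite -RintegralD//.
have U0 : 0 < \int[mu]_(z in D) (u z ^+ 2).
  rewrite lt_neqAle Rintegral_ge0 ?andbT; last by move=> z _; exact: sqr_ge0.
  apply/eqP => U0; apply: unz.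
  have : (\int[mu]_(z in D) `|(u z ^+ 2)%:E| = 0)%E.
    under eq_integral do rewrite gee0_abs ?lee_fin ?sqr_ge0//.
    rewrite -[LHS]fineK; last exact: integrable_fin_num.
    by rewrite -[fine _]/(\int[mu]_(z in D) (u z ^+ 2)) -U0.
  move/(ae_eq_integral_abs mu mD (measurable_int mu iu)).
  apply: filterS => z uz Dz; have /= [] := uz Dz => /eqP.
  by rewrite sqrf_eq0 => /eqP.
move: le; have fu := integrable_fin_num mD iu.
have f1 := integrable_fin_num mD i1; have f2 := integrable_fin_num mD i2.
rewrite -(fineK fu) -(fineK f1) -(fineK f2) -EFinM -EFinD lee_fin.
rewrite -[fine (\int[mu]_(z in D) (u z ^+ 2)%:E)%E]/(\int[mu]_(z in D) (u z ^+ 2)).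
rewrite -[fine (\int[mu]_(z in D) (p1 z ^+ 2)%:E)%E]/(\int[mu]_(z in D) (p1 z ^+ 2)).
rewrite -[fine (\int[mu]_(z in D) (p2 z ^+ 2)%:E)%E]/(\int[mu]_(z in D) (p2 z ^+ 2)).
by rewrite -pe eqn ue ler_pM2r.
Qed.

(** * Choice of the constants and the eigenvalue bound *)

Theorem theorem4p1 (R : realType) (l : R) (g : R -> R)
    (N : nat) (kappa : R) (omega : int -> R) (lambda : R)
    (hl : 1 <= l)
    (hg : C20 l g)
    (hg1 : Num.max (Num.max (Cnorm l g) (Cnorm l (derive1 g))) (Cnorm l (derive1 (derive1 g))) = 1)
    (hN : (0 < N)%N)
    (hkappa : 0 < kappa)
    (homega : forall k : int, 0 <= omega k)
    (hlambda : is_lowest_eigenvalue (waveguide l g kappa omega N)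
                 (waveguide_Gamma l g kappa omega N) lambda)
    (hsmall : kappa * omega_norm omega N <=
       3%:R / 5000%:R * L2norm l (gtilde l g) ^+ 2 * (1 / (l ^+ 7 * N%:R ^+ 7))) :
  lambda - 1 >=
    3%:R / 2%:R * L2norm l (gtilde l g) ^+ 2 *
      (kappa ^+ 2 * omega_norm omega N ^+ 2 / (l ^+ 3 * N%:R ^+ 3)).
Proof.
have l0 : 0 < l by lra.
have cg := C20_continuous hg; have cg' := C20_derive_continuous hg.
have gout := C20_out hg; have dg := C20_is_derive hg.
have [gl g'l] : Cnorm l g <= 1 /\ Cnorm l (derive1 g) <= 1.
  by rewrite -hg1; split; rewrite !le_max lexx ?orbT.
have g1 x : `|g x| <= 1.
  have [xl|xl] := boolP (0 <= x <= l); first exact: le_trans (Cnorm_ub cg xl) gl.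
  rewrite gout ?normr0//; apply: contra xl => /andP[? ?]; lra.
have g'1 x : `|derive1 g x| <= 1.
  have [xl|xl] := boolP (0 <= x <= l); first exact: le_trans (Cnorm_ub cg' xl) g'l.
  by rewrite (C20_derive_out hg) ?normr0.
have [P dP] := continuous_primitive cg.
pose gbar := l^-1 * (P l - P 0).
have gbarE : gtilde l g = fun x => g x - gbar.
  apply/funext => x; rewrite /gtilde /Rintegral (integral_cc_is_derive (ltW l0) cg (fun x _ => dP x)).
  by [].
have gbar1 : `|gbar| <= 1.
  rewrite normrM normfV (gtr0_norm l0) ler_pdivrMl// mulr1.
  by have := @increment_abs R P g 0 l 1 (ltW l0) dP (fun x _ => g1 x); rewrite mul1r subr0.
have ct : continuous (fun x => (g x - gbar) ^+ 2) by solve_continuous.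
have [Q2 dQ2] := continuous_primitive ct.
set n2 := L2norm l (gtilde l g) ^+ 2 in hsmall *.
have n2E : n2 = Q2 l - Q2 0.
  have E : \int[lebesgue_measure]_(x in `]0, l[) (gtilde l g x) ^+ 2 = Q2 l - Q2 0.
    by rewrite gbarE /Rintegral (integral_oo_is_derive (ltW l0) ct (fun x _ => dQ2 x)).
  rewrite /n2 /L2norm sqr_sqrtr ?E//.
  by rewrite -E; apply: Rintegral_ge0 => x _; exact: sqr_ge0.
have n20 : 0 <= n2 by exact: sqr_ge0.
(* Both g and its mean are at most 1 in absolute value, so the integrand is at most 4. *)
have n24 : n2 <= 4 * l.
  rewrite n2E; apply: le_trans (ler_norm _) _; rewrite -[X in _ * X](subr0 l).
  apply: increment_abs (ltW l0) dQ2 _ => x _; rewrite ger0_norm ?sqr_ge0//.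
  have -> : 4 = 2 ^+ 2 :> R by lra.
  by apply: sqr_le_of_norm; apply: le_trans (ler_normB _ _) _; have := g1 x; lra.
pose L := N%:R * l; pose eps := kappa * omega_norm omega N.
have N1 : 1 <= N%:R :> R by rewrite ler1n.
have L1 : 1 <= L by rewrite -[1]mul1r; apply: ler_pM.
have lL : l <= L by rewrite /L ler_peMl// ltW.
have NL : N%:R <= L by rewrite /L ler_peMr.
have L0 : 0 < L by exact: lt_le_trans l0 lL.
have eps0 : 0 <= eps by rewrite mulr_ge0 ?omega_norm_ge0// ltW.
have epsL : 5000 * (eps * L ^+ 7) <= 3 * n2.
  have : eps * L ^+ 7 <= 3 / 5000 * n2.
    move: hsmall; rewrite mul1r -[l ^+ 7 * _]mulrC -exprMn -/L -/eps.
    by rewrite ler_pdivlMr ?exprn_gt0.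
  by clear; lra.
(* [B] bounds both |F| and |f|, and [V] is the variance bound summed over the cells. *)
pose B := N%:R * eps; pose V := kappa ^+ 2 * omega_norm omega N ^+ 2 * n2.
(* [V] regrouped for comparison with [epsL], which is the smallness assumption with l^7 N^7 =
   L^7. *)
have VE : V = eps ^+ 2 * n2 by rewrite /V /eps exprMn.
have B0 : 0 <= B by rewrite mulr_ge0.
(* 5000 eps L^7 <= 3 n2 <= 12 L gives eps L^6 <= 12/5000 = 3/1250, and B L = N eps L <= eps L^6. *)
have BL : B * L <= 3 / 1250.
  have h1 : 5000 * (eps * L ^+ 6) <= 12.
    rewrite -(ler_pM2r L0); have -> : 5000 * (eps * L ^+ 6) * L = 5000 * (eps * L ^+ 7) by ring.
    by clear -epsL n24 lL; lra.
  have h2 : B * L <= eps * L ^+ 6.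
    have -> : B * L = eps * (N%:R * L) by rewrite /B; ring.
    apply: ler_wpM2l => //; apply: le_trans (_ : L * L <= _); first by rewrite ler_wpM2r// ltW.
    by rewrite -expr2; apply: ler_weXn2l.
  by clear -h1 h2; lra.
(* B^3 L^4 <= eps^2 (eps L^7) <= 3/5000 V, and 1600 times 3/5000 is 0.96. *)
have BV : 1600 * B ^+ 3 * L ^+ 4 <= V.
  have h1 : B ^+ 3 <= eps ^+ 3 * L ^+ 3.
    rewrite /B exprMn mulrC; apply: ler_wpM2l; first exact: exprn_ge0.
    by apply: lerXn2r => //; rewrite nnegrE// ltW.
  have h2 : B ^+ 3 * L ^+ 4 <= eps ^+ 2 * (eps * L ^+ 7).
    have -> : eps ^+ 2 * (eps * L ^+ 7) = eps ^+ 3 * L ^+ 3 * L ^+ 4 by ring.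
    by apply: ler_wpM2r => //; rewrite exprn_ge0// ltW.
  have h3 : eps ^+ 2 * (5000 * (eps * L ^+ 7)) <= eps ^+ 2 * (3 * n2).
    by apply: ler_wpM2l => //; exact: sqr_ge0.
  have h4 : 0 <= eps ^+ 2 * n2 by rewrite mulr_ge0 ?sqr_ge0.
  by rewrite VE; clear -h2 h3 h4; lra.
pose F x := kappa * cell_sum l g omega N x.
pose f x := kappa * \sum_(k < N) omega k%:Z * derive1 g (x - k%:R * l).
have dF (x : R) : is_derive x 1 F (f x).
  have := is_derive_cell_sum l omega N dg x => ?.
  by apply: is_derive_eq; rewrite /f /GRing.scale/=; ring.
have cF : continuous F by move=> x; exact: is_derive_continuous (dF x).
have cf : continuous f.
  have csum := @continuous_cell_sum R l omega N _ cg'.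
  by rewrite /f; solve_continuous.
have FB x : 0 <= x <= L -> `|F x| <= B.
  move=> _; rewrite /F normrM (gtr0_norm hkappa) /B /eps mulrCA.
  by apply: ler_wpM2l; [exact: ltW|exact: cell_sum_norm].
have fB x : 0 <= x <= L -> `|f x| <= B.
  move=> _; rewrite /f normrM (gtr0_norm hkappa) /B /eps mulrCA.
  by apply: ler_wpM2l; [exact: ltW|exact: cell_sum_norm].
have hV M (Q : R -> R) : (forall x : R, is_derive x 1 Q ((F x - M) ^+ 2)) -> V <= Q L - Q 0.
  move=> dQ; rewrite /V n2E.
  apply: (@cell_variance R l g omega l0 gout N kappa M Q Q2 (fun x => P x - gbar * x) gbar) => //.
    by move=> x; have := dP x => ?; apply: is_derive_eq; rewrite /GRing.scale/=; ring.
  by rewrite /gbar; field; rewrite gt_eqF.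
have [s [s' [c [c' [t [r [[ct' cr cs' cc'] [ds [dc [[s0 sL c0 cL] H]]]]]]]]]] :=
  exists_corrector L1 B0 BL BV cf dF FB fB hV.
set Lam := 1 + 3 / 2 * (V / L ^+ 3) in H.
have Lam0 : 0 <= Lam.
  rewrite /Lam addr_ge0// mulr_ge0// divr_ge0 ?exprn_ge0// ?(ltW L0)//.
  by rewrite VE mulr_ge0 ?sqr_ge0.
(* As L = N l, the claimed lower bound is exactly Lam - 1. *)
suff : Lam <= lambda.
  rewrite lerBrDl; apply: le_trans; rewrite /Lam lerD2l le_eqVlt; apply/orP; left; apply/eqP.
  have Nn0 : N%:R != 0 :> R by rewrite gt_eqF ?ltr0n.
  have ln0 : l != 0 by rewrite gt_eqF.
  by rewrite /V /L; clear -Nn0 ln0; field; rewrite ln0 Nn0.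
have GF x : 0 < x < L -> kappa * G l g omega x = F x.
  by move=> xL; rewrite /F (G_cell_sum omega l0 gout xL).
have DE : waveguide l g kappa omega N = strip L pi F.
  apply/seteqP; split => z /= [z1 z2]; split => //; [by rewrite -GF|by rewrite GF].
have GamF x : 0 < x < L -> waveguide_Gamma l g kappa omega N (x, F x) /\
    waveguide_Gamma l g kappa omega N (x, F x + pi).
  by move=> xL; split; split => //=; rewrite GF//; [left|right].
have [[u [unz [_ [p1 [p2 [fd weak]]]]]] _] := hlambda.
(* The eigenfunction is taken as its own test function, which yields the Rayleigh identity. *)
have {weak} eqn := weak u p1 p2 fd.
rewrite DE in eqn unz fd.
have [[mu_ iu] [mp1 i1] [mp2 i2] [phi [tphi cu cp1 cp2]]] := fd.
have mD := @measurable_strip R L pi F cF.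
apply: (ratio_le_of_integral_identity mD mu_ mp1 mp2 iu i1 i2 unz eqn).
have mphi n : [/\ continuous (phi n), continuous (d1 (phi n)) & continuous (d2 (phi n))].
  by have [sphi _] := tphi n; have [? [_ _ [? _] [? _]]] := sphi 1%N.
apply: (form_inequality_limit mD (phi := phi) (a := fun n => d1 (phi n))
  (b := fun n => d2 (phi n)) Lam0 mu_ mp1 mp2 _ _ _ cu cp1 cp2).
- by move=> n; apply: continuous_measurable_prod; case: (mphi n).
- by move=> n; apply: continuous_measurable_prod; case: (mphi n).
- by move=> n; apply: continuous_measurable_prod; case: (mphi n).
- move=> n.
  exact: (calibration_strip L0 Lam0 cf ct' cr cs' cc' dF ds dc s0 sL c0 cL H GamF (tphi n)).
- by rewrite ltey_eq (integrable_fin_num mD i1).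
- by rewrite ltey_eq (integrable_fin_num mD i2).
Qed.
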